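(* Let $p,q\ge0$, $p+q>0$, and let $f\in\mathfrak{H}_{\mathbb{C}}^{\odot p}\otimes\mathfrak{H}_{\mathbb{C}}^{\odot q}$ have the expansion $$f=\sum_{k_1,\dots,k_p,j_1,\dots,j_q=1}^{\infty}b_{p,q}(\mathbf{k},\mathbf{j})\,\big(\mathrm{symm}(e_{k_1}\otimes\cdots\otimes e_{k_p})\otimes\mathrm{symm}(\overline{e_{j_1}}\otimes\cdots\otimes\overline{e_{j_q}})\big),$$ where $b_{p,q}(\mathbf{k},\mathbf{j})=b(k_1,\dots,k_p;j_1,\dots,j_q)\in\mathbb{C}$ satisfy $\sum_{k_1,\dots,k_p,j_1,\dots,j_q=1}^\infty|b_{p,q}(\mathbf{k},\mathbf{j})|^2<\infty$. Then $\mathcal{I}_{p,q}(f)$ admits the unique representation $$\begin{aligned}\mathcal{I}_{p,q}(f)&=\sum_{k_1,\dots,k_p,j_1,\dots,j_q=1}^{\infty}I_{p+q}\big(\mathrm{Re}(b_{p,q}(\mathbf{k},\mathbf{j}))\,u_{p,q}(\mathbf{k},\mathbf{j})-\mathrm{Im}(b_{p,q}(\mathbf{k},\mathbf{j}))\,v_{p,q}(\mathbf{k},\mathbf{j})\big)\\&\quad+\mathrm{i}\sum_{k_1,\dots,k_p,j_1,\dots,j_q=1}^{\infty}I_{p+q}\big(\mathrm{Im}(b_{p,q}(\mathbf{k},\mathbf{j}))\,u_{p,q}(\mathbf{k},\mathbf{j})+\mathrm{Re}(b_{p,q}(\mathbf{k},\mathbf{j}))\,v_{p,q}(\mathbf{k},\mathbf{j})\big),\end{aligned}$$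 where $I_{p+q}(\cdot)$ is the real $(p+q)$-th Wiener-Itô integral with respect to $W$, the series converge in $L^2(\Omega)$, and uniqueness means that the kernels in $(\mathfrak{H}\oplus\mathfrak{H})^{\odot(p+q)}$ of the real and imaginary parts of $\mathcal{I}_{p,q}(f)$ are uniquely determined.
   Context: $\mathfrak{H}$ is a real separable Hilbert space, $\mathfrak{H}_{\mathbb{C}}$ its complexification (inner product linear in the first variable), $\mathfrak{H}\oplus\mathfrak{H}$ the Hilbert direct sum; $^{\odot n}$ is the $n$-th symmetric tensor power, $\mathrm{symm}$ the symmetrization, $f\tilde\otimes g=\mathrm{symm}(f\otimes g)$. $X$, $Y$ are two independent isonormal Gaussian processes over $\mathfrak{H}$ (centered Gaussian families with $\mathbb{E}[X(h)X(g)]=\langle h,g\rangle_{\mathfrak{H}}$, likewise $Y$). $W(h,f)=X(h)+Y(f)$ is an isonormal Gaussian process over $\mathfrak{H}\oplus\mathfrak{H}$. For $\mathfrak{h}=f+\mathrm{i}g\in\mathfrak{H}_{\mathbb{C}}$ put $X_{\mathbb{C}}(\mathfrak{h})=X(f)+\mathrm{i}X(g)$, similarly $Y_{\mathbb{C}}$, and $Z(\mathfrak{h})=(X_{\mathbb{C}}(\mathfrak{h})+\mathrm{i}Y_{\mathbb{C}}(\mathfrak{h}))/\sqrt2$ (complex isonormal Gaussian process). $\Lambda$ is the set of sequences $\mathbf{a}=\{a_k\}_{k\ge1}$ of non-negative integers with finite sum $|\mathbf{a}|$. Real integrals: Hermite polynomials are defined by $\exp\{tx-t^2/2\}=\sum_n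 \frac{t^n}{n!}H_n(x)$. For a complete orthonormal system $\{\eta_k\}$ of $\mathfrak{H}\oplus\mathfrak{H}$, $I_n$ is the linear isometry from $(\mathfrak{H}\oplus\mathfrak{H})^{\odot n}$ with norm $\sqrt{n!}\|\cdot\|$ onto the $n$-th Wiener chaos of $W$ given by $I_n(\mathrm{symm}(\otimes_k\eta_k^{\otimes m_k}))=\prod_kH_{m_k}(W(\eta_k))$, $\mathbf{m}\in\Lambda$, $|\mathbf{m}|=n$; $I_0$ is the identity. Complex integrals: complex Hermite polynomials are defined by $\exp\{\lambda\bar z+\bar\lambda z-2|\lambda|^2\}=\sum_{p,q\ge0}\frac{\bar\lambda^p\lambda^q}{p!q!}J_{p,q}(z)$. For a complete orthonormal system $\{\xi_k\}$ of $\mathfrak{H}_{\mathbb{C}}$, $\mathcal{I}_{p,q}$ is the linear isometry from $\mathfrak{H}_{\mathbb{C}}^{\odot p}\otimes\mathfrak{H}_{\mathbb{C}}^{\odot q}$ with norm $\sqrt{p!q!}\|\cdot\|$ into $L^2_{\mathbb{C}}(\Omega)$ given by $\mathcal{I}_{p,q}(\mathrm{symm}(\otimes_k\xi_k^{\otimes p_k})\otimes\mathrm{symm}(\otimes_k\overline{\xi}_k^{\otimes q_k}))=\prod_k2^{-(p_k+q_k)/2}J_{p_k,q_k}(\sqrt2Z(\xi_k))$, $\mathbf p,\mathbf q\in\Lambda$, $|\mathbf p|=p,|\mathbf q|=q$. $\{e_k=e_k^1+\mathrm{i}e_k^2\}_{k\ge1}$ ($e_k^1,e_k^2\in\mathfrak{H}$)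 is a complete orthogonal system in $\mathfrak{H}_{\mathbb{C}}$ with $\|e_k\|=\sqrt2$; $u_{1,0}(k)=\frac1{\sqrt2}(e_k^1,-e_k^2)$, $v_{1,0}(k)=\frac1{\sqrt2}(e_k^2,e_k^1)$ in $\mathfrak{H}\oplus\mathfrak{H}$. The elements $u_{p,q}(\mathbf{k},\mathbf{j})=u_{p,q}(k_1,\dots,k_p;j_1,\dots,j_q)$ and $v_{p,q}(\mathbf{k},\mathbf{j})=v_{p,q}(k_1,\dots,k_p;j_1,\dots,j_q)$ of $(\mathfrak{H}\oplus\mathfrak{H})^{\odot(p+q)}$ are defined recursively by $u_{0,1}(j)=u_{1,0}(j)$, $v_{0,1}(j)=-v_{1,0}(j)$ and $$\begin{aligned}u_{p,q}(\mathbf{k},\mathbf{j})&=u_{p-1,q}(\mathbf{k},\mathbf{j})\tilde\otimes u_{1,0}(k_p)-v_{p-1,q}(\mathbf{k},\mathbf{j})\tilde\otimes v_{1,0}(k_p)\\&=u_{p,q-1}(\mathbf{k},\mathbf{j})\tilde\otimes u_{0,1}(j_q)-v_{p,q-1}(\mathbf{k},\mathbf{j})\tilde\otimes v_{0,1}(j_q),\\ v_{p,q}(\mathbf{k},\mathbf{j})&=u_{p-1,q}(\mathbf{k},\mathbf{j})\tilde\otimes v_{1,0}(k_p)+v_{p-1,q}(\mathbf{k},\mathbf{j})\tilde\otimes u_{1,0}(k_p)\\&=u_{p,q-1}(\mathbf{k},\mathbf{j})\tilde\otimes v_{0,1}(j_q)+v_{p,q-1}(\mathbf{k},\mathbf{j})\tilde\otimes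 u_{0,1}(j_q),\end{aligned}$$ for $p+q\ge2$ (the $p-1$ forms when $p\ge1$, the $q-1$ forms when $q\ge1$; they agree, so the definition is consistent). Here $u_{p-1,q}(\mathbf k,\mathbf j)$ uses $k_1,\dots,k_{p-1};j_1,\dots,j_q$ and $u_{p,q-1}(\mathbf k,\mathbf j)$ uses $k_1,\dots,k_p;j_1,\dots,j_{q-1}$. *)

(* Defs.v *)
From HB Require Import structures.
From mathcomp Require Import all_boot all_order all_fingroup all_algebra.
From mathcomp Require Import finmap complex ring.
From mathcomp Require Import all_classical all_reals all_analysis.
Set Implicit Arguments.
Unset Strict Implicit.
Unset Printing Implicit Defensive.
Import Order.TTheory GRing.Theory Num.Theory.
Import numFieldNormedType.Exports.
Import ComplexField.
Local Open Scope classical_set_scope.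
Local Open Scope ring_scope.
Local Open Scope complex_scope.

(* The scalar field K is either a real field with [theta := idfun] or R[i]     *)
(* with [theta := Num.conj]; [dot x x] is the squared norm.  In R[i],         *)
(* [0 < eps] and [x < eps] force eps and x to be real.                         *)
Section InnerProductSpace.
Context {K : numFieldType} {theta : K -> K}.
Context {V : lmodType K} (dot : {dot V for theta}).

Definition cauchy_in (u : nat -> V) : Prop :=
  forall eps, 0 < eps -> exists N : nat, forall m n, (N <= m)%N -> (N <= n)%N ->
    dot (u m - u n) (u m - u n) < eps.

Definition cvg_in (u : nat -> V) (l : V) : Prop :=
  forall eps, 0 < eps -> exists N : nat, forall n, (N <= n)%N ->
    dot (u n - l) (u n - l) < eps.

Definition complete_space : Prop :=
  forall u, cauchy_in u -> exists l, cvg_in u l.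

Definition closure_in (A : set V) : set V :=
  [set x | forall eps, 0 < eps -> exists2 y, A y & dot (x - y) (x - y) < eps].

Definition separable_space : Prop :=
  exists D : nat -> V, closure_in (range D) = setT.

Definition span (A : set V) : set V :=
  [set x | exists (n : nat) (c : 'I_n -> K) (y : 'I_n -> V),
     (forall i, A (y i)) /\ x = \sum_(i < n) c i *: y i].

Definition closed_span (A : set V) : set V := closure_in (span A).

Definition complete_orthogonal_system (e : nat -> V) : Prop :=
  [/\ forall k l, k <> l -> dot (e k) (e l) = 0,
      forall k, e k <> 0 &
      closed_span (range e) = setT].

Definition complete_orthonormal_system (e : nat -> V) : Prop :=
  complete_orthogonal_system e /\ forall k, dot (e k) (e k) = 1.

(* Sums over a countable index set are unordered sums. *)
Definition has_sum (I : choiceType) (f : I -> V) (s : V) : Prop :=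
  forall eps, 0 < eps -> exists A : {fset I}, forall B : {fset I},
    fsubset A B ->
    dot (\sum_(i <- B) f i - s) (\sum_(i <- B) f i - s) < eps.

End InnerProductSpace.

Record hilbert (K : numFieldType) (theta : K -> K) := Hilbert {
  hsort :> lmodType K;
  hdot : {dot hsort for theta};
  hilbert_complete : complete_space hdot
}.
Arguments hdot {K theta}.


Section DirectSum.
Context {R : realType} {U V : lmodType R}.
Variables (dU : {dot U for @idfun R}) (dV : {dot V for @idfun R}).

Definition sum_dot (x y : (U * V)%type) : R := dU x.1 y.1 + dV x.2 y.2.

Let sum_dotBl y : zmod_morphism (sum_dot ^~ y).
Proof. by move=> a b; rewrite /sum_dot/= !linearBl opprD addrACA. Qed.

Let sum_dotBr x : zmod_morphism (sum_dot x).
Proof. by move=> a b; rewrite /sum_dot/= !linearBr opprD addrACA. Qed.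

Let sum_dotZl y : scalable_for *%R (sum_dot ^~ y).
Proof. by move=> c a; rewrite /sum_dot/= !linearZl_LR -mulrDr. Qed.

Let sum_dotZr x : scalable_for (@idfun R \; *%R) (sum_dot x).
Proof. by move=> c a; rewrite /sum_dot/= !linearZr_LR/= -mulrDr. Qed.

HB.instance Definition _ := isBilinear.Build R _ _ _ *%R (@idfun R \; *%R)
  sum_dot sum_dotBl sum_dotBr sum_dotZl sum_dotZr.

Let sum_dot_sym x y : sum_dot x y = (-1) ^+ false * @idfun R (sum_dot y x).
Proof.
by rewrite expr0 mul1r /sum_dot/= (hermC dU) (hermC dV) !expr0 !mul1r.
Qed.

HB.instance Definition _ :=
  isHermitianSesquilinear.Build R _ false (@idfun R) sum_dot sum_dot_sym.

Let sum_dot_gt0 x : x != 0 -> 0 < sum_dot x x.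
Proof.
have ge0 (W : lmodType R) (dW : {dot W for @idfun R}) (w : W) : 0 <= dW w w.
  have [->|/neq0_dnorm_gt0/ltW//] := eqVneq w 0.
  by rewrite linear0l.
case: x => a b; rewrite xpair_eqE negb_and => /orP[a0|b0].
  by rewrite ltr_wpDr ?ge0 ?neq0_dnorm_gt0.
by rewrite ltr_wpDl ?ge0 ?neq0_dnorm_gt0.
Qed.

HB.instance Definition _ := isDotProduct.Build R _ sum_dot sum_dot_gt0.

End DirectSum.

(* The element f + i g of the complexification is the pair (f, g). *)
Definition complexification (V : Type) : Type := (V * V)%type.

Section Complexification.
Context {R : realType} {V : lmodType R}.
Local Notation VC := (complexification V).

HB.instance Definition _ := GRing.Zmodule.copy VC (V * V)%type.

Definition complexification_scale (a : R[i]) (x : VC) : VC :=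
  (complex.Re a *: x.1 - complex.Im a *: x.2,
   complex.Re a *: x.2 + complex.Im a *: x.1).

Let scaleA a b x : complexification_scale a (complexification_scale b x) =
  complexification_scale (a * b) x.
Proof.
case: a b x => [a a'] [b b'] [f g]; rewrite /complexification_scale/=.
rewrite !scalerDr !scalerN !scalerDl !scaleNr !scalerA.
congr pair; rewrite -!addrA; congr (_ + _).
  by rewrite !opprD [RHS]addrC -addrA.
by rewrite [RHS]addrC -addrA.
Qed.

Let scale1 : left_id 1 complexification_scale.
Proof.
by case=> f g; rewrite /complexification_scale/= !scale1r !scale0r subr0 addr0.
Qed.

Let scaleDr : right_distributive complexification_scale +%R.
Proof.
move=> a [f g] [f' g']; rewrite /complexification_scale/= !scalerDr.
by congr pair; rewrite ?opprD addrACA.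
Qed.

Let scaleDl x : {morph complexification_scale^~ x : a b / a + b}.
Proof.
case: x => f g [a a'] [b b']; rewrite /complexification_scale/= !scalerDl.
by congr pair; rewrite ?opprD addrACA.
Qed.

HB.instance Definition _ := GRing.Zmodule_isLmodule.Build R[i] VC
  scaleA scale1 scaleDr scaleDl.

Definition vconj (x : VC) : VC := (x.1, - x.2).

Variable dV : {dot V for @idfun R}.

Definition cdot (x y : VC) : R[i] :=
  (dV x.1 y.1 + dV x.2 y.2) +i* (dV x.2 y.1 - dV x.1 y.2).

Let cdotBl y : zmod_morphism (cdot ^~ y).
Proof.
move=> a b; apply/eqP; rewrite eq_complex /cdot/= !linearBl.
by apply/andP; split; apply/eqP; ring.
Qed.

Let cdotBr x : zmod_morphism (cdot x).
Proof.
move=> a b; apply/eqP; rewrite eq_complex /cdot/= !linearBr.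
by apply/andP; split; apply/eqP; ring.
Qed.

Let cdotZl y : scalable_for *%R (cdot ^~ y).
Proof.
move=> [c c'] a; apply/eqP; rewrite eq_complex /cdot/=.
rewrite !linearDl !linearNl !linearZl_LR/=.
by apply/andP; split; apply/eqP; ring.
Qed.

Let cdotZr x : scalable_for (@Num.conj R[i] \; *%R) (cdot x).
Proof.
move=> [c c'] a; apply/eqP; rewrite eq_complex /cdot/=.
rewrite !linearDr !linearNr !linearZr_LR/=.
by apply/andP; split; apply/eqP; ring.
Qed.

HB.instance Definition _ := isBilinear.Build R[i] _ _ _ *%R
  (@Num.conj R[i] \; *%R) cdot cdotBl cdotBr cdotZl cdotZr.

Let cdot_herm x y : cdot x y = (-1) ^+ false * @Num.conj R[i] (cdot y x).
Proof.
have sym a b : dV a b = dV b a by rewrite (hermC dV) expr0 mul1r.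
rewrite expr0 mul1r /cdot; apply/eqP; rewrite eq_complex/=.
rewrite (sym y.1 x.1) (sym y.2 x.2) (sym y.2 x.1) (sym y.1 x.2).
by rewrite opprB !eqxx.
Qed.

HB.instance Definition _ :=
  isHermitianSesquilinear.Build R[i] _ false (@Num.conj R[i]) cdot cdot_herm.

Let cdot_gt0 x : x != 0 -> 0 < cdot x x.
Proof.
move=> x0; rewrite ltcE/=; apply/andP; split.
  by rewrite (hermC dV) expr0 mul1r subrr.
exact: (@neq0_dnorm_gt0 _ _ _ (sum_dot dV dV) x).
Qed.

HB.instance Definition _ := isDotProduct.Build R[i] _ cdot cdot_gt0.

End Complexification.

(* Hilbert tensor products, up to the canonical isometric isomorphism: a      *)
(* bilinear map x, y |-> x (x) y into a Hilbert space T with                  *)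
(* <x (x) y, x' (x) y'> = <x, x'> <y, y'> and a total set of elementary       *)
(* tensors.                                                                   *)
Definition hilbert_tensor (K : numFieldType) (theta : K -> K)
    (U V : lmodType K) (dU : {dot U for theta}) (dV : {dot V for theta})
    (T : hilbert theta) (ten : {bilinear U -> V -> T}) : Prop :=
  (forall x x' y y', hdot T (ten x y) (ten x' y') = dU x x' * dV y y') /\
  closed_span (hdot T) [set ten xy.1 xy.2 | xy in [set: U * V]] = setT.

(* Iterated powers: the 0-th one is the line spanned by a unit vector, the    *)
(* (n+1)-st one is the tensor product of the n-th one with V.                 *)
Record tensor_tower (K : numFieldType) (theta : K -> K)
    (V : lmodType K) (dV : {dot V for theta}) := TensorTower {
  tpow : nat -> hilbert theta;
  tone : tpow 0;
  tone_norm : hdot (tpow 0) tone tone = 1;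
  tone_line : forall x : tpow 0, exists a, x = a *: tone;
  tmul : forall n, {bilinear tpow n -> V -> tpow n.+1};
  tmulP : forall n, hilbert_tensor (hdot (tpow n)) dV (tmul n)
}.
Arguments tone {K theta V dV}.
Arguments tmul {K theta V dV}.

Section PureTensor.
Context {K : numFieldType} {theta : K -> K}.
Context {V : lmodType K} {dV : {dot V for theta}} (TT : tensor_tower dV).

Fixpoint pure (n : nat) : ('I_n -> V) -> tpow TT n :=
  match n with
  | 0 => fun _ => tone TT
  | n'.+1 => fun x =>
      tmul TT n' (pure (fun i : 'I_n' => x (widen_ord (leqnSn n') i))) (x ord_max)
  end.

End PureTensor.

Record tensor_powers (K : numFieldType) (theta : K -> K)
    (V : lmodType K) (dV : {dot V for theta}) := TensorPowers {
  ttower :> tensor_tower dV;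
  symm : forall n, {linear tpow ttower n -> tpow ttower n};
  symm_bounded : forall n, exists C : K, forall F : tpow ttower n,
    hdot (tpow ttower n) (symm n F) (symm n F) <= C * hdot (tpow ttower n) F F;
  symm_pure : forall n (x : 'I_n -> V), symm n (pure ttower x) =
    (n`!%:R)^-1 *: \sum_(s : 'S_n) pure ttower (x \o s)
}.
Arguments symm {K theta V dV}.

Section SymmetricPowers.
Context {K : numFieldType} {theta : K -> K}.
Context {V : lmodType K} {dV : {dot V for theta}} (TP : tensor_powers dV).

Definition sympow (n : nat) : set (tpow TP n) := [set F | symm TP n F = F].

Definition tvec (x : V) : tpow TP 1 := tmul TP 0 (tone TP) x.

Definition symten (n : nat) (F : tpow TP n) (x : V) : tpow TP n.+1 :=
  symm TP n.+1 (tmul TP n F x).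

(* (x)_(k < N) (s k)^{(x) m k}, for n = \sum_(k < N) m k. *)
Definition pure_powers (n N : nat) (m : nat -> nat) (s : nat -> V) : tpow TP n :=
  let l := flatten [seq nseq (m k) (s k) | k <- iota 0 N] in
  pure TP (fun i : 'I_n => nth 0 l i).

End SymmetricPowers.

(* V^{sym p} (x) W^{sym q} as a closed subspace of V^{(x) p} (x) W^{(x) q}. *)
Definition sympow_tensor (K : numFieldType) (theta : K -> K)
    (V : lmodType K) (dV : {dot V for theta}) (TP : tensor_powers dV) (p q : nat)
    (S : hilbert theta) (ten : {bilinear tpow TP p -> tpow TP q -> S}) : set S :=
  closed_span (hdot S)
    [set ten FG.1 FG.2 | FG in [set FG | sympow FG.1 /\ sympow FG.2]].

(* Multi-indices: a has N as a bound for its support and |a| = n. *)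
Definition multi_index (N n : nat) (a : nat -> nat) : Prop :=
  (forall k, (N <= k)%N -> a k = 0%N) /\ (\sum_(k < N) a k)%N = n.

Section HermitePolynomials.
Variable R : realType.

Definition hermite_polynomials (He : nat -> R -> R) : Prop :=
  forall t x : R,
    series (fun n => t ^+ n / n`!%:R * He n x) @ \oo --> expR (t * x - t ^+ 2 / 2).

(* The exponent of the complex generating function is a real number; the      *)
(* double series is an unordered sum.                                         *)
Definition complex_hermite_polynomials (J : nat -> nat -> R[i] -> R[i]) : Prop :=
  forall l z : R[i],
  let term (pq : nat * nat) : R[i] :=
    (l^*)%C ^+ pq.1 * l ^+ pq.2 / (pq.1`! * pq.2`!)%:R * J pq.1 pq.2 z in
  let value : R[i] :=
    (expR (complex.Re (l * (z^*)%C + (l^*)%C * z - 2 * `|l| ^+ 2)))%:C in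
  forall eps : R, 0 < eps -> exists A : {fset nat * nat},
    forall B : {fset nat * nat}, fsubset A B ->
    Normc.normc (\sum_(pq <- B) term pq - value) < eps.

End HermitePolynomials.

Section Probability.
Context {disp : measure_display} {Om : measurableType disp} {R : realType}.
Variable P : probability Om R.

Definition centered_gaussian (Y : Om -> R) : Prop :=
  exists2 s : R, 0 <= s & forall B : set R, measurable B ->
    P (Y @^-1` B) = (if s == 0 then \d_(0 : R) B else normal_prob 0 s B).

Section Isonormal.
Context {V : lmodType R} (dV : {dot V for @idfun R}).

Definition isonormal (X : V -> {RV P >-> R}) : Prop :=
  (forall (n : nat) (c : 'I_n -> R) (h : 'I_n -> V),
     centered_gaussian (fun w => \sum_(i < n) c i * X (h i) w)) /\
  (forall h g, 'E_P[fun w => (X h w * X g w)%R] = (dV h g)%:E)%E.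

Definition generated_sigma_algebra (X : V -> {RV P >-> R}) : set (set Om) :=
  <<s [set X hB.1 @^-1` hB.2 | hB in [set hB : V * set R | measurable hB.2]] >>.

Definition independent_processes (X Y : V -> {RV P >-> R}) : Prop :=
  forall A B, generated_sigma_algebra X A -> generated_sigma_algebra Y B ->
    P (A `&` B) = (P A * P B)%E.

End Isonormal.

Definition W_process {V : lmodType R} (X Y : V -> {RV P >-> R})
    (h : (V * V)%type) : Om -> R := fun w => X h.1 w + Y h.2 w.

Definition complex_process {V : lmodType R} (X : V -> {RV P >-> R})
    (h : complexification V) : Om -> R[i] := fun w => X h.1 w +i* X h.2 w.

Definition Z_process {V : lmodType R} (X Y : V -> {RV P >-> R})
    (h : complexification V) : Om -> R[i] :=
  fun w => (complex_process X h w + (0 +i* 1) * complex_process Y h w)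
           / (Num.sqrt 2)%:C.

Definition L2norm (Y : Om -> R) : \bar R := 'N[P]_2%:E[EFin \o Y].

Definition L2_sum (I : choiceType) (F : I -> Om -> R) (Y : Om -> R) : Prop :=
  forall eps : R, 0 < eps -> exists A : {fset I}, forall B : {fset I},
    fsubset A B ->
    (L2norm (fun w => (\sum_(i <- B) F i w) - Y w)%R < eps%:E)%E.

Section RealIntegral.
Context {V : lmodType R} {dV : {dot V for @idfun R}} (TP : tensor_powers dV).
Variables (W : V -> Om -> R) (He : nat -> R -> R).

Definition wiener_chaos (n : nat) : set (Om -> R) :=
  [set Y | Y \in Lfun P 2%:E /\
     forall eps : R, 0 < eps ->
     exists (m : nat) (c : 'I_m -> R) (h : 'I_m -> V),
       (forall i, dV (h i) (h i) = 1) /\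
       (L2norm (fun w => Y w - \sum_(i < m) c i * He n (W (h i) w))%R < eps%:E)%E].

(* Elements of L^2 are represented by functions, up to equality a.e. *)
Record wiener_ito_integral (eta : nat -> V) (n : nat)
    (I : tpow TP n -> Om -> R) : Prop := WienerItoIntegral {
  wi_linear : forall a F G, sympow F -> sympow G ->
    {ae P, forall w, I (a *: F + G) w = a * I F w + I G w};
  wi_isometry : forall F, sympow F ->
    L2norm (I F) = (Num.sqrt n`!%:R * Num.sqrt (hdot (tpow TP n) F F))%:E;
  wi_chaos : forall F, sympow F -> wiener_chaos n (I F);
  wi_onto : forall Y, wiener_chaos n Y ->
    exists2 F, sympow F & {ae P, forall w, I F w = Y w};
  wi_hermite : forall N m, multi_index N n m ->
    {ae P, forall w, I (symm TP n (pure_powers TP n N m eta)) w =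
                     \prod_(k < N) He (m k) (W (eta k) w)}
}.

End RealIntegral.

Section ComplexIntegral.
Context {V : lmodType R} {dV : {dot V for @idfun R}}.
Variable TP : tensor_powers (cdot dV).
Variables (Z : complexification V -> Om -> R[i]).
Variable J : nat -> nat -> R[i] -> R[i].

Record complex_wiener_ito_integral (xi : nat -> complexification V) (p q : nat)
    (S : hilbert (@Num.conj R[i])) (ten : {bilinear tpow TP p -> tpow TP q -> S})
    (I : S -> Om -> R[i]) : Prop := ComplexWienerItoIntegral {
  cwi_L2 : forall f, sympow_tensor ten f ->
    (fun w => complex.Re (I f w)) \in Lfun P 2%:E /\
    (fun w => complex.Im (I f w)) \in Lfun P 2%:E;
  cwi_linear : forall a f g, sympow_tensor ten f -> sympow_tensor ten g ->
    {ae P, forall w, I (a *: f + g) w = a * I f w + I g w};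
  cwi_isometry : forall f, sympow_tensor ten f ->
    L2norm (fun w => Normc.normc (I f w)) =
    (Num.sqrt (p`! * q`!)%:R * Num.sqrt (complex.Re (hdot S f f)))%:E;
  cwi_hermite : forall N a b, multi_index N p a -> multi_index N q b ->
    {ae P, forall w,
       I (ten (symm TP p (pure_powers TP p N a xi))
              (symm TP q (pure_powers TP q N b (fun k => vconj (xi k))))) w =
       \prod_(k < N) ((2 `^ (- (a k + b k)%:R / 2))%:C *
                      J (a k) (b k) ((Num.sqrt 2)%:C * Z (xi k) w))}
}.

End ComplexIntegral.
End Probability.

Section Kernels.
Context {R : realType} {V : lmodType R} {dV : {dot V for @idfun R}}.
Variable TP : tensor_powers (sum_dot dV dV).
Variable e : nat -> complexification V.

Definition u10 (k : nat) : (V * V)%type :=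
  (Num.sqrt 2)^-1 *: ((e k).1, - (e k).2).
Definition v10 (k : nat) : (V * V)%type :=
  (Num.sqrt 2)^-1 *: ((e k).2, (e k).1).
Definition u01 (j : nat) : (V * V)%type := u10 j.
Definition v01 (j : nat) : (V * V)%type := - v10 j.

Definition uv_step (n : nat) :
    tpow TP n * tpow TP n -> (V * V)%type -> (V * V)%type ->
    tpow TP n.+1 * tpow TP n.+1 :=
  match n with
  | 0 => fun _ a b => (tvec TP a, tvec TP b)
  | n'.+1 => fun uv a b =>
      (symten uv.1 a - symten uv.2 b, symten uv.1 b + symten uv.2 a)
  end.

(* The pair (u_{p,q}, v_{p,q}), obtained from (p-1, q) when p > 0 and from    *)
(* (0, q-1) when p = 0; the value at (0, 0) is irrelevant.  The recursion     *)
(* from (p, q-1) for p, q > 0 gives the same elements.                        *)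
Fixpoint uv0 (q : nat) : ('I_q -> nat) -> tpow TP q * tpow TP q :=
  match q with
  | 0 => fun _ => (0, 0)
  | q'.+1 => fun j =>
      uv_step (uv0 (fun i : 'I_q' => j (widen_ord (leqnSn q') i)))
        (u01 (j ord_max)) (v01 (j ord_max))
  end.

Fixpoint uv (p q : nat) :
    ('I_p -> nat) -> ('I_q -> nat) -> tpow TP (p + q) * tpow TP (p + q) :=
  match p with
  | 0 => fun _ j => uv0 j
  | p'.+1 => fun k j =>
      @uv_step (p' + q) (uv (fun i : 'I_p' => k (widen_ord (leqnSn p') i)) j)
        (u10 (k ord_max)) (v10 (k ord_max))
  end.

Definition u_kernel (p q : nat) (kj : p.-tuple nat * q.-tuple nat) :
  tpow TP (p + q) := (uv (tnth kj.1) (tnth kj.2)).1.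
Definition v_kernel (p q : nat) (kj : p.-tuple nat * q.-tuple nat) :
  tpow TP (p + q) := (uv (tnth kj.1) (tnth kj.2)).2.

End Kernels.

(* Main.v *)
(* All quantities are compared with Wick polynomials, which are defined on words
   of letters by the recursion
     :a s: = a :s: - sum_i E[a s_i] :s with s_i removed:
   and are multilinear in the letters.  On an orthonormal system they are the
   products of Hermite polynomials (real case) or of complex Hermite polynomials
   (letters Z(xi_k) and their conjugates), so both I and the complex integral
   agree with them on pure tensors of basis vectors.  Both sides are multilinear
   and continuous in each slot, hence agree on all pure tensors; this includes
   the change of basis from (eta_k) and (xi_k) to (e_k).  Since
   Z(e_k) = W(u_{1,0}(k)) + i W(v_{1,0}(k)), expanding a Wick polynomial in Z(e_k)
   and the conjugates of the Z(e_j) into real and imaginary parts follows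
   exactly the recursion of u_{p,q} and v_{p,q}.  Summation over the multi-indices
   and uniqueness come from the isometry properties, and the kernels of the sums
   exist because I maps onto the chaos. *)

Require Import Defs.
From HB Require Import structures.
From mathcomp Require Import all_boot all_order all_fingroup all_algebra.
From mathcomp Require Import finmap complex ring lra zify.
From mathcomp Require Import all_classical all_reals all_analysis measurable_realfun.
Import Order.TTheory GRing.Theory Num.Theory.
Import numFieldNormedType.Exports.
Import ComplexField.
Local Open Scope classical_set_scope.
Local Open Scope ring_scope.
Local Open Scope complex_scope.

Set Implicit Arguments.
Unset Strict Implicit.
Unset Printing Implicit Defensive.

(** * Entire power series and Hermite polynomials *)

Section EntireSeries.
Context {R : realType}.
Implicit Types c : R^nat.

(** The obstacle is that the rules available for [W], [Z] and the two integrals hold only off a null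
    set that depends on the vectors involved, so neither multilinearity nor density can be used
    pathwise. Identities are therefore carried from a total set to its closure by a quantitative
    continuity in probability: up to a random factor independent of the vector, the value is bounded
    by something small in mean. Wick polynomials fit this scheme because each single letter enters
    linearly, through its sample and its covariances, with coefficients built from the other
    letters; the random factor is read off pathwise, and no moment of a Wick polynomial has to be
    computed. This also replaces explicit formulas for Hermite polynomials under a change of
    orthonormal system. The Hermite side has to supply only recurrences. They are extracted from the
    generating functions; for [J] this goes through the rays [r * l] with [r] real, so that only
    power series in one real variable are differentiated. *)

Lemma is_cvg_pseries_diffs c :
  (forall x, cvgn (pseries c x)) -> forall x, cvgn (pseries (pseries_diffs c) x).
Proof.
(* The factor 2 absorbs the new coefficient, since [n + 1 <= 2 ^ n]; the summand 1 gives [M >= 1],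
   so that [M ^ n] may be raised to [M ^ n.+1], a term of the convergent series at [M]. *)
move=> cc x; pose M := 2 * `|x| + 1.
have M1 : 1 <= M by rewrite lerDr mulr_ge0.
have M0 : 0 <= M by rewrite (le_trans _ M1).
have cM : cvgn (pseries (fun i => `|c i|) M).
  apply: (@is_cvg_pseries_inside_norm _ c (M + 1)) => //.
  by rewrite !ger0_norm// ?addr_ge0// ltrDl.
apply: normed_cvg; apply: (@series_le_cvg _ _ (fun i => `|c i.+1| * M ^+ i.+1)).
- by move=> n /=.
- by move=> n /=; rewrite mulr_ge0// exprn_ge0.
- move=> n; rewrite /= /pseries_diffs normrM normrM normr_nat normrX.
  rewrite (mulrC _ `|c n.+1|) -mulrA ler_wpM2l//.
  apply: (@le_trans _ _ (M ^+ n)); last by rewrite exprS ler_peMl// exprn_ge0.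
  apply: (@le_trans _ _ ((2 * `|x|) ^+ n)); last first.
    by rewrite lerXn2r ?nnegrE ?mulr_ge0// /M lerDl.
  rewrite exprMn ler_wpM2r ?exprn_ge0// -natrX ler_nat.
  by rewrite ltn_expl.
have /cvg_ex[l cl] := cM; apply/cvg_ex; exists (l - `|c 0%N|).
rewrite [X in X @ \oo --> _](_ : _ =
    (fun n => pseries (fun i => `|c i|) M n.+1 - `|c 0%N|)); last first.
  apply/funext => n; rewrite /pseries /series/= big_nat_recl//.
  by rewrite expr0 mulr1 addrC addKr.
apply: cvgB; last exact: cvg_cst.
by move: cl; rewrite -cvg_shiftS.
Qed.

Lemma is_derive_pseries c : (forall x, cvgn (pseries c x)) ->
  forall x : R, is_derive x (1 : R) (fun x => limn (pseries c x))
    (limn (pseries (pseries_diffs c) x)).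
Proof.
move=> cc x; have cd := is_cvg_pseries_diffs cc.
have cdd := is_cvg_pseries_diffs cd.
apply: (@pseries_snd_diffs _ c (`|x| + 1)) => //.
by rewrite (@ger0_norm _ (`|x| + 1)) ?addr_ge0// ltrDl.
Qed.

Lemma cvg_pseries0 c : pseries c 0 @ \oo --> c 0%N.
Proof.
rewrite -cvg_shiftS [X in X @ \oo --> _](_ : _ = cst (c 0%N)); last first.
  apply/funext => m; rewrite /pseries /series/= big_nat_recl// big1 ?addr0.
    by rewrite expr0 mulr1.
  by move=> i _; rewrite expr0n mulr0.
exact: cvg_cst.
Qed.

(** The constant term is the value at 0, and the derived series vanishes identically too, with n-th
    coefficient [n.+1%:R * c n.+1]; hence an induction on [n] for all [c] at once. *)
Lemma pseries_eq0 c n : (forall x, pseries c x @ \oo --> (0 : R)) -> c n = 0.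
Proof.
elim: n c => [|n ih] c c0.
  by rewrite -(cvg_lim (@norm_hausdorff _ R) (@cvg_pseries0 c)); apply: cvg_lim.
have cc x : cvgn (pseries c x) by apply/cvg_ex; exists 0.
have E : (fun x => limn (pseries c x)) = cst 0.
  by apply/funext => x; apply/cvg_lim.
suff /ih : forall x, pseries (pseries_diffs c) x @ \oo --> (0 : R).
  by move=> /eqP; rewrite mulf_eq0 pnatr_eq0/= => /eqP.
move=> x; have h : cvgn (pseries (pseries_diffs c) x) by exact: is_cvg_pseries_diffs.
suff -> : 0 = limn (pseries (pseries_diffs c) x) :> R by exact: h.
have [_ <-] := is_derive_pseries cc x.
by rewrite E derive_cst.
Qed.

(* Differentiating exp (A r - B r^2 / 2) turns into a recurrence for its
   Taylor coefficients. *)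
Lemma gauss_series_rec c (A B : R) :
  (forall r, pseries c r @ \oo --> expR (r * A - r ^+ 2 * B / 2)) ->
  [/\ c 0%N = 1, c 1%N = A &
      forall n, n.+2%:R * c n.+2 = A * c n.+1 - B * c n].
Proof.
move=> cF; have cc x : cvgn (pseries c x).
  by apply/cvg_ex; eexists; exact: cF.
have E : (fun x => limn (pseries c x)) = fun r => expR (r * A - r ^+ 2 * B / 2).
  by apply/funext => x; apply/cvg_lim.
have dF (x : R) : pseries (pseries_diffs c) x @ \oo -->
    (A - x * B) * expR (x * A - x ^+ 2 * B / 2).
  have h : cvgn (pseries (pseries_diffs c) x) by exact: is_cvg_pseries_diffs.
  suff -> : (A - x * B) * expR (x * A - x ^+ 2 * B / 2) =
    limn (pseries (pseries_diffs c) x) by exact: h.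
  have [_ <-] := is_derive_pseries cc x.
  rewrite E; have D : is_derive x (1 : R) (fun r : R => r * A - r ^+ 2 * B / 2) (A - x * B).
    apply: is_derive_eq; rewrite /= /GRing.scale/=.
    by field.
  have D2 : is_derive (x * A - x ^+ 2 * B / 2) (1 : R) (expR : R -> R) (expR (x * A - x ^+ 2 * B / 2)).
    exact: is_derive_expR.
  have := @is_derive1_comp _ expR (fun r : R => r * A - r ^+ 2 * B / 2) _ _ _ D2 D.
  by case=> _ /=; rewrite mulrC => <-.
(* [d] collects the Taylor coefficients of F' - (A - r B) F, which is 0 for F the exponential.
   Multiplication by r shifts [c] by one place, whence the 0 at [n = 0]. *)
pose d n := pseries_diffs c n - A * c n + B * (if n is m.+1 then c m else 0).
have d0 n : d n = 0.
  apply: pseries_eq0 => x.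
  rewrite [X in X @ \oo --> _](_ : _ = pseries (pseries_diffs c) x \+
     (- A) \*: pseries c x \+ (B * x) \*: (fun n => if n is m.+1 then pseries c x m else 0)); last first.
    apply/funext => m; rewrite /pseries/series/= /GRing.scale/=.
    rewrite /d; under eq_bigr do rewrite mulrDl mulrDl.
    rewrite !big_split/=; congr (_ + _ + _).
      by rewrite mulr_sumr; apply: eq_bigr => i _; ring.
    case: m => [|m]; first by rewrite big_geq// mulr0.
    rewrite big_nat_recl// mulr0 mul0r add0r mulr_sumr.
    by apply: eq_bigr => i _; rewrite exprS; ring.
  rewrite [X in _ --> X](_ : _ = (A - x * B) * expR (x * A - x ^+ 2 * B / 2) +
    (- A) *: expR (x * A - x ^+ 2 * B / 2) + (B * x) *: expR (x * A - x ^+ 2 * B / 2)); last first.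
    by rewrite /GRing.scale/=; ring.
  apply: cvgD; first apply: cvgD.
  - exact: dF.
  - apply: cvgZr; exact: cF.
  - apply: cvgZr; rewrite -cvg_shiftS; exact: cF.
have c0 : c 0%N = 1.
  have := cF 0; rewrite mul0r expr0n/= !mul0r subr0 expR0 => h.
  by rewrite -(cvg_lim (@norm_hausdorff _ R) (@cvg_pseries0 c)); apply: cvg_lim.
split => //.
  have := d0 0%N; rewrite /d/= /pseries_diffs c0 !mulr1 mulr0 addr0 mul1r.
  by move/subr0_eq.
move=> n; have := d0 n.+1; rewrite /d/= /pseries_diffs => h.
by apply/eqP; rewrite -subr_eq0; apply/eqP; rewrite -[RHS]h; ring.
Qed.

End EntireSeries.

Section ComplexParts.
Context {R : realType}.
Implicit Types x y : R[i].

Lemma Re_add x y : complex.Re (x + y) = complex.Re x + complex.Re y.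
Proof. by case: x y => [? ?] [? ?]. Qed.

Lemma Im_add x y : complex.Im (x + y) = complex.Im x + complex.Im y.
Proof. by case: x y => [? ?] [? ?]. Qed.

Lemma Re_sum I (r : seq I) (F : I -> R[i]) :
  complex.Re (\sum_(i <- r) F i) = \sum_(i <- r) complex.Re (F i).
Proof. exact: (big_morph _ Re_add). Qed.

Lemma Im_sum I (r : seq I) (F : I -> R[i]) :
  complex.Im (\sum_(i <- r) F i) = \sum_(i <- r) complex.Im (F i).
Proof. exact: (big_morph _ Im_add). Qed.

Lemma Re_realM (a : R) x : complex.Re (a%:C * x) = a * complex.Re x.
Proof. by case: x => b c; simpc. Qed.

Lemma Im_realM (a : R) x : complex.Im (a%:C * x) = a * complex.Im x.
Proof. by case: x => b c; simpc. Qed.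

Lemma normc_ge_absRe x : `|complex.Re x| <= Normc.normc x.
Proof.
by case: x => a b; rewrite /= -sqrtr_sqr ler_sqrt ?lerDl ?sqr_ge0// addr_ge0 ?sqr_ge0.
Qed.

Lemma normc_ge_absIm x : `|complex.Im x| <= Normc.normc x.
Proof.
by case: x => a b; rewrite /= -sqrtr_sqr ler_sqrt ?lerDr ?sqr_ge0// addr_ge0 ?sqr_ge0.
Qed.

End ComplexParts.

Section Hermite.
Context {R : realType}.

(** This is [gauss_series_rec] for the coefficients [He n x / n!], with A = x and B = 1, after
    clearing factorials. At [n = 0] the value of [n.-1] is harmless because of the factor [n%:R]. *)
Lemma hermite_rec (He : nat -> R -> R) x : hermite_polynomials He ->
  He 0%N x = 1 /\ forall n, He n.+1 x = x * He n x - n%:R * He n.-1 x.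
Proof.
move=> HeP; have [|h0 h1 h2] := @gauss_series_rec R (fun n => He n x / n`!%:R) x 1.
  move=> r; have := HeP r x; rewrite mulr1.
  rewrite (_ : series _ = pseries (fun n => He n x / n`!%:R) r)//.
  by apply/funext => n; rewrite /pseries/series/=; apply: eq_bigr => i _; ring.
move: h0 h1; rewrite /= fact0 invr1 !mulr1 => h0 h1; split=> // -[|n].
  by rewrite h0 h1 mul0r subr0 mulr1.
have f0 m : m`!%:R != 0 :> R by rewrite pnatr_eq0 -lt0n fact_gt0.
have := h2 n; rewrite !factS !natrM mul1r => /(congr1 (fun y => y * (n.+1%:R * n`!%:R))).
have n1 : 1 + n%:R != 0 :> R by rewrite nat1r pnatr_eq0.
have n2 : 2 + n%:R != 0 :> R by rewrite -natrD pnatr_eq0.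
have -> : n.+2%:R = 2 + n%:R :> R by rewrite -natrD.
have -> : n.+1%:R = 1 + n%:R :> R by rewrite nat1r.
move=> h; apply: (etrans (etrans _ h)); field; rewrite ?f0 ?n1 ?n2//.
Qed.

End Hermite.

(** * Complex Hermite polynomials recovered from their generating function *)

Section ComplexHermite.

(** The variable [w] stands for the conjugate of [z]; keeping the two independent makes the
    recurrences identities in any commutative ring. The factor 2 comes from the term -2|lambda|^2 of
    the generating function. *)
Fixpoint complex_hermite (K : comPzRingType) (z w : K) (p q : nat) : K :=
  match p with
  | 0 => w ^+ q
  | p'.+1 => z * complex_hermite z w p' q - q%:R * 2 * complex_hermite z w p' q.-1
  end.

Lemma complex_hermiteSr (K : comPzRingType) (z w : K) p q :
  complex_hermite z w p q.+1 =
  w * complex_hermite z w p q - p%:R * 2 * complex_hermite z w p.-1 q.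
Proof.
elim: p q => [|p ih] q /=; first by rewrite exprS !mul0r subr0.
pose j := complex_hermite z w.
have h1 : p%:R * j p q - (p%:R * z * j p.-1 q - 2 * p%:R * q%:R * j p.-1 q.-1) = 0.
  by case: p {ih} => [|p] /=; rewrite /j/=; ring.
have h2 : q%:R * j p q - (q%:R * w * j p q.-1 - 2 * p%:R * q%:R * j p.-1 q.-1) = 0.
  by case: q {h1} => [|q] /=; rewrite /j ?ih; ring.
apply/eqP; rewrite -subr_eq0; apply/eqP; rewrite ih -!natr1 -/j.
by transitivity (2 * 0 - 2 * 0 : K); [rewrite -{1}h1 -h2; ring|ring].
Qed.

(** The sum of p times the recurrence in p and q times the recurrence in q. Differentiating the
    generating function along rays sees only the total degree, so this is the form in which [J] can
    be compared. *)
Lemma complex_hermite_sum_rec (K : comPzRingType) (z w : K) p q :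
  (p + q)%:R * complex_hermite z w p q =
  q%:R * w * complex_hermite z w p q.-1 + p%:R * z * complex_hermite z w p.-1 q
  - 4 * (p * q)%:R * complex_hermite z w p.-1 q.-1.
Proof.
have h1 : p%:R * complex_hermite z w p q = p%:R * z * complex_hermite z w p.-1 q
   - 2 * (p * q)%:R * complex_hermite z w p.-1 q.-1.
  by case: p => [|p] /=; rewrite ?natrM; ring.
have h2 : q%:R * complex_hermite z w p q = q%:R * w * complex_hermite z w p q.-1
   - 2 * (p * q)%:R * complex_hermite z w p.-1 q.-1.
  by case: q {h1} => [|q] /=; rewrite ?complex_hermiteSr ?natrM; ring.
by rewrite natrD mulrDl h1 h2; ring.
Qed.

Context {R : realType} (J : nat -> nat -> R[i] -> R[i]).
Hypothesis JP : complex_hermite_polynomials J.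
Variable z : R[i].

Let a p q : R[i] := J p q z / (p`! * q`!)%:R.
(** The homogeneous part of degree [n] of the double series. On the ray [r * l], with [r] real, the
    double series becomes the power series in [r] with these coefficients. *)
Let hcoef (l : R[i]) n := \sum_(i < n.+1) (l^*)%C ^+ (n - i) * l ^+ i * a (n - i) i.

Let hcoef_scale (r : R) l n : hcoef (r%:C * l) n = (r ^+ n)%:C * hcoef l n.
Proof.
rewrite /hcoef mulr_sumr; apply: eq_bigr => i _.
have -> : ((r%:C * l)^*)%C = r%:C * (l^*)%C.
  by case: l => b c; apply/eqP; rewrite eq_complex/=; apply/andP; split; apply/eqP; ring.
have -> : (r ^+ n)%:C = r%:C ^+ (n - i) * r%:C ^+ i.
  by rewrite -exprD subnK ?rmorphXn// -ltnS.
by rewrite !exprMn; ring.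
Qed.

Let triangle N : seq (nat * nat) := [seq ((n - i)%N, i) | n <- iota 0 N, i <- iota 0 n.+1].

Let mem_triangle N pq : (pq \in triangle N) = (pq.1 + pq.2 < N)%N.
Proof.
apply/allpairsPdep/idP => [[n [i []]]|h].
  by rewrite !mem_iota/= !add0n ltnS => nN ni ->/=; rewrite subnK.
exists (pq.1 + pq.2)%N, pq.2; rewrite !mem_iota/= !add0n h ltnS leq_addl addnK.
by split => //; case: (pq).
Qed.

Let triangle_uniq N : uniq (triangle N).
Proof.
apply: allpairs_uniq_dep => [|n _|]; [exact: iota_uniq|exact: iota_uniq|].
move=> [n i] [m j] /allpairsPdep[n' [i' [_ h1 [e1 e2]]]].
move=> /allpairsPdep[m' [j' [_ h2 [e3 e4]]]] [e5 e6]; move: h1 h2.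
rewrite !mem_iota/= !ltnS -e1 -e2 -e3 -e4 => h1 h2.
rewrite -e6 in h2 e5 *; congr existT.
by rewrite -(subnK h1) -(subnK h2) e5.
Qed.

(** An unordered sum may be sampled along any exhausting family of finite sets. The sets
    [triangle N], made of the antidiagonals of degree below [N], turn it into a limit of partial
    sums by degree. *)
Let hseries (l : R[i]) (eps : R) : 0 < eps -> \forall N \near \oo,
  Normc.normc (\sum_(0 <= n < N) hcoef l n -
    (expR (complex.Re (l * (z^*)%C + (l^*)%C * z - 2 * `|l| ^+ 2)))%:C) < eps.
Proof.
move=> /(JP l z)[A /= AP].
(* Beyond this bound [triangle N] contains the finite set [A] of the unordered sum. *)
exists (\max_(pq <- A) (pq.1 + pq.2).+1)%N => // N /= hN.
have [B BE Bp] : exists2 B : {fset nat * nat}, B =i triangle N & perm_eq B (triangle N).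
  exists (seq_fset tt (triangle N)); first exact: seq_fsetE.
  by rewrite -[X in perm_eq _ X]undup_id ?seq_fset_perm.
have AB : fsubset A B.
  apply/fsubsetP => pq pqA; rewrite BE mem_triangle; apply: leq_trans hN.
  exact: (@leq_bigmax_seq _ _ xpredT (fun pq => (pq.1 + pq.2).+1)).
have := AP B AB; rewrite (perm_big _ Bp)/= big_allpairs_dep/=.
rewrite /index_iota subn0; set s1 := \sum_(_ <- _) _; set s2 := \sum_(_ <- _) _.
suff -> : s1 = s2 by [].
apply: eq_bigr => n _; rewrite /hcoef -(big_mkord xpredT (fun i =>
  (l^*)%C ^+ (n - i) * l ^+ i * a (n - i) i)) /index_iota subn0.
by apply: eq_bigr => i _; rewrite /a; ring.
Qed.

Let trace (l : R[i]) : R := complex.Re (l * (z^*)%C + (l^*)%C * z).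
Let sqabs (l : R[i]) : R := complex.Re l ^+ 2 + complex.Im l ^+ 2.

Let exponentE l (r : R) :
  complex.Re (r%:C * l * (z^*)%C + ((r%:C * l)^*)%C * z - 2 * `|r%:C * l| ^+ 2) =
  r * trace l - r ^+ 2 * (4 * sqabs l) / 2.
Proof.
rewrite /trace /sqabs sqr_normc; case: l z => [x y] [u v] /=; simpc.
by rewrite /=; field.
Qed.

(** Along a ray the exponent is real and equals r A - r^2 B / 2 with A = [trace l] and B =
    [4 * sqabs l]. Hence the imaginary parts form a power series with sum 0 and vanish, while
    [gauss_series_rec] governs the real parts. *)
Let hcoef_rec l : [/\ hcoef l 0%N = 1, hcoef l 1%N = l * (z^*)%C + (l^*)%C * z &
  forall n, n.+2%:R * hcoef l n.+2 =
    (l * (z^*)%C + (l^*)%C * z) * hcoef l n.+1 - 4 * (l * (l^*)%C) * hcoef l n].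
Proof.
have cvgRe r : pseries (fun n => complex.Re (hcoef l n)) r @ \oo -->
    expR (r * trace l - r ^+ 2 * (4 * sqabs l) / 2).
  apply/cvgrPdist_lt => eps /(hseries (r%:C * l)); rewrite exponentE.
  apply: filterS => N /(le_lt_trans (normc_ge_absRe _)); rewrite distrC.
  rewrite Re_add Re_sum /pseries /series/= (_ : \sum_(_ <= _ < _) _ =
    \sum_(0 <= k < N) complex.Re (hcoef l k) * r ^+ k)//.
  by apply: eq_bigr => i _; rewrite hcoef_scale Re_realM mulrC.
have cvgIm r : pseries (fun n => complex.Im (hcoef l n)) r @ \oo --> (0 : R).
  apply/cvgrPdist_lt => eps /(hseries (r%:C * l)); rewrite exponentE.
  apply: filterS => N /(le_lt_trans (normc_ge_absIm _)); rewrite sub0r normrN.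
  rewrite Im_add Im_sum /pseries /series/= oppr0 addr0 (_ : \sum_(_ <= _ < _) _ =
    \sum_(0 <= k < N) complex.Im (hcoef l k) * r ^+ k)//.
  by apply: eq_bigr => i _; rewrite hcoef_scale Im_realM mulrC.
have Im0 n : complex.Im (hcoef l n) = 0 by exact: (pseries_eq0 _ cvgIm).
have hE n : hcoef l n = (complex.Re (hcoef l n))%:C.
  by move: (Im0 n); case: (hcoef l n) => x y /= ->.
have tE : l * (z^*)%C + (l^*)%C * z = (trace l)%:C.
  rewrite /trace; case: (l) (z) => [x y] [u v]; simpc; apply/eqP.
  by rewrite eq_complex/= eqxx/=; apply/eqP; ring.
have sE : l * (l^*)%C = (sqabs l)%:C.
  rewrite /sqabs; case: (l) => [x y]; simpc; apply/eqP.
  by rewrite eq_complex/=; apply/andP; split; apply/eqP; ring.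
have [c0 c1 c2] := gauss_series_rec cvgRe; rewrite tE sE; split.
- by rewrite hE c0.
- by rewrite hE c1.
- move=> n; rewrite (hE n.+2) (hE n.+1) (hE n) -!(rmorph_nat (real_complex R)) -!rmorphM -rmorphB c2.
  by congr (_%:C); ring.
Qed.

(** For a fixed [l] only the sum [hcoef l n] is controlled, not each [a p q]. Dividing by the n-th
    power of the conjugate of [l] turns that sum into the value of [P n] at the quotient of [l] by
    its conjugate, and varying the quotient separates the coefficients. *)
Let P n := \poly_(i < n.+1) a (n - i) i.

Let hcoefE (l : R[i]) n : l != 0 -> hcoef l n = (l^*)%C ^+ n * (P n).[l / (l^*)%C].
Proof.
move=> l0; have l0' : (l^*)%C != 0 by rewrite conjc_eq0.
rewrite horner_poly mulr_sumr; apply: eq_bigr => i _.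
have /subnK e : (i <= n)%N by rewrite -ltnS.
rewrite -[in X in _ = X * _]e exprD expr_div_n.
have := expf_neq0 i l0' => l1.
by field.
Qed.

(** The quotients take infinitely many values: those of the points 1 + i m, for m natural, are
    pairwise distinct, so [size Q] of them are too many roots for a nonzero [Q]. *)
Let poly0 (Q : {poly R[i]}) :
  (forall l : R[i], l != 0 -> root Q (l / (l^*)%C)) -> Q = 0.
Proof.
move=> Q0; apply/eqP; apply: contraT => nQ.
pose x (m : nat) : R[i] := (1 +i* m%:R) / (1 -i* m%:R).
have n0 (m : nat) : (1 -i* m%:R : R[i]) != 0.
  by rewrite eq_complex/= oner_eq0.
have := @max_poly_roots _ Q [seq x m | m <- iota 0 (size Q)] nQ.
rewrite size_map size_iota ltnn => -> //.
  apply/allP => _ /mapP[m _ ->]; have := Q0 (1 +i* m%:R); apply.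
  by rewrite eq_complex/= oner_eq0.
rewrite map_inj_uniq ?iota_uniq// => m n; rewrite /x => /eqP.
rewrite eqr_div//; simpc; rewrite eq_complex/= => /andP[_ /eqP h].
by apply/eqP; rewrite -(eqr_nat R); apply/eqP; lra.
Qed.

Let coefP n i : (P n)`_i = if (i <= n)%N then a (n - i) i else 0.
Proof. by rewrite coef_poly ltnS. Qed.

Let P_rec n : n.+1%:R *: P n.+1 =
  ((z^*)%C *: 'X + z%:P) * P n - 4 *: 'X * (if n is m.+1 then P m else 0).
Proof.
apply/eqP; rewrite -subr_eq0; apply/eqP; apply: poly0 => l l0; apply/rootP.
have l0' : (l^*)%C != 0 by rewrite conjc_eq0.
have := expf_neq0 n.+1 l0' => ln.
have [h0 h1 h2] := hcoef_rec l.
apply: (mulfI ln); rewrite mulr0 !(hornerD, hornerN, hornerM, hornerZ, hornerX, hornerC).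
case: n ln => [|n] ln.
  rewrite horner0 mulr0 subr0 mulrBr mul1r -hcoefE//.
  have := hcoefE 0 l0; rewrite expr0 mul1r h0 => <-.
  by rewrite h1; field.
rewrite exprS.
have -> : (l^*)%C * (l^*)%C ^+ n.+1 * (n.+2%:R * (P n.+2).[l / (l^*)%C] -
   (((z^*)%C * (l / (l^*)%C) + z) * (P n.+1).[l / (l^*)%C] -
   4 * (l / (l^*)%C) * (P n).[l / (l^*)%C])) =
   n.+2%:R * ((l^*)%C ^+ n.+2 * (P n.+2).[l / (l^*)%C]) -
   ((l * (z^*)%C + (l^*)%C * z) * ((l^*)%C ^+ n.+1 * (P n.+1).[l / (l^*)%C]) -
     4 * (l * (l^*)%C) * ((l^*)%C ^+ n * (P n).[l / (l^*)%C])).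
  by rewrite !exprS; field.
by rewrite -!hcoefE// h2 subrr.
Qed.

Let a_rec p q : (0 < p + q)%N -> (p + q)%:R * a p q =
  (if q is q'.+1 then (z^*)%C * a p q' else 0) +
  (if p is p'.+1 then z * a p' q else 0) -
  (if p is p'.+1 then if q is q'.+1 then 4 * a p' q' else 0 else 0).
Proof.
case pqn : (p + q)%N => [//|n] _; have := congr1 (coefp q) (P_rec n).
rewrite /= coefZ coefP ifT; last by rewrite -pqn leq_addl.
rewrite (_ : (n.+1 - q = p)%N); last by rewrite -pqn addnK.
move=> ->.
rewrite mulrDl coefB coefD -!scalerAl !coefZ !coefXM coefCM.
case: q pqn => [|q] pqn /=.
  rewrite !mulr0 !add0r coefP leq0n subn0; move: pqn; rewrite addn0 => ->.
  by rewrite !subr0.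
move: pqn; rewrite addnS => -[pqn].
rewrite !coefP -pqn leq_addl addnK; case: p pqn => [|p] pqn.
  rewrite add0n ltnn; congr (_ + _ - _); rewrite ?mulr0//.
  by rewrite ?add0n; case: q {pqn} => [|q]; rewrite ?coef0 ?coefP ?ltnn ?mulr0.
by rewrite addSn coefP leq_addl addnK ltnS leq_addl subSS addnK.
Qed.

Let J_rec p q : (0 < p + q)%N -> (p + q)%:R * J p q z =
  q%:R * (z^*)%C * J p q.-1 z + p%:R * z * J p.-1 q z
  - 4 * (p * q)%:R * J p.-1 q.-1 z.
Proof.
have f0 m : m`!%:R != 0 :> R[i] by rewrite pnatr_eq0 -lt0n fact_gt0.
have s0 m : 1 + m%:R != 0 :> R[i] by rewrite nat1r pnatr_eq0.
move=> /a_rec; rewrite /a => /(congr1 (fun x => x * (p`! * q`!)%:R)).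
rewrite -mulrA divfK ?natrM ?mulf_neq0// => ->.
by case: p => [|p]; case: q => [|q]; rewrite /= ?factS ?natrM -?nat1r ?fact0; field;
  rewrite ?f0 ?s0.
Qed.

(** Both sides obey the degree-weighted recurrence, which determines them by induction on p + q, as
    p + q is invertible when positive. *)
Lemma complex_hermiteE p q : J p q z = complex_hermite z (z^*)%C p q.
Proof.
have [n pqn] := ubnP (p + q); elim: n p q pqn => // n ih p q pqn.
have [pq0|pq0] := posnP (p + q)%N.
  move: pq0 => /eqP; rewrite addn_eq0 => /andP[/eqP -> /eqP ->].
  have [+ _ _] := hcoef_rec 0.
  by rewrite /hcoef big_ord1 /a !expr0 !mul1r fact0 mul1n divr1.
have pqC : (p + q)%:R != 0 :> R[i] by rewrite pnatr_eq0 -lt0n.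
apply: (mulfI pqC); rewrite J_rec// complex_hermite_sum_rec.
case: p pqn pq0 {pqC} => [|p] pqn pq0; case: q pqn pq0 => [|q] pqn pq0 //=;
  rewrite ?mul0r ?muln0 ?mul0n ?mulr0 ?mul0r !ih//; lia.
Qed.

End ComplexHermite.

(** * Wick polynomials *)

Section Wick.
Context {K : comPzRingType} {T : eqType}.
Implicit Types (v : T -> K) (B : T -> T -> K) (s t : seq T).

(** Every way of taking one occurrence out of a word, the rest keeping its order; repeated letters
    are listed with multiplicity, as the sum over contractions requires. *)
Fixpoint splits s : seq (T * seq T) :=
  if s is a :: s' then (a, s') :: [seq (p.1, a :: p.2) | p <- splits s'] else [::].

Lemma splits_cat s d t : splits (s ++ d :: t) =
  [seq (p.1, p.2 ++ d :: t) | p <- splits s] ++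
  (d, s ++ t) :: [seq (p.1, s ++ d :: p.2) | p <- splits t].
Proof.
elim: s => [|a s ih] //=; rewrite ih map_cat/= -!map_comp.
by congr (_ :: _ ++ _ :: _).
Qed.

Lemma size_splits s p : p \in splits s -> size s = (size p.2).+1.
Proof.
elim: s p => [//|a s ih] p /=; rewrite inE => /predU1P[->//|].
by case/mapP => q /ih/= e ->; rewrite /= e.
Qed.

(** The words with a letter removed are not subterms of the given word, so the recursion runs on a
    bound for the length. *)
Fixpoint wick_fuel v B n s : K :=
  match n, s with
  | n'.+1, a :: s' => v a * wick_fuel v B n' s' -
      \sum_(p <- splits s') B a p.1 * wick_fuel v B n' p.2
  | _, _ => 1
  end.

(* The Wick polynomial of the letters [s], whose values are given by [v] and
   whose covariances are given by [B]. *)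
Definition wick v B s := wick_fuel v B (size s) s.

Lemma wick_fuelE v B n s : (size s <= n)%N -> wick_fuel v B n s = wick v B s.
Proof.
have [m sm] := ubnP (size s); elim: m s n sm => // m ih s n.
case: s => [|a s] /= sm; first by case: n.
case: n => // n sn; rewrite /wick /= ih//; congr (_ - _).
apply: eq_big_seq => p /size_splits ps.
have h1 : (size p.2 < m)%N by move: sm; rewrite ltnS ps; apply: ltnW.
have h2 : (size p.2 <= n)%N by move: sn; rewrite ltnS ps; apply: ltnW.
by rewrite !ih// ps.
Qed.

Lemma wick_cons v B a s : wick v B (a :: s) =
  v a * wick v B s - \sum_(p <- splits s) B a p.1 * wick v B p.2.
Proof.
rewrite /wick/=; congr (_ - _); apply: eq_big_seq => p ps.
by rewrite wick_fuelE// (size_splits ps).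
Qed.

Section OneSlot.
Variables (v : T -> K) (B : T -> T -> K).
Hypothesis Bsym : forall a b, B a b = B b a.

Let affine (f : T -> K) := exists (c0 : K) (l : seq (K * T)),
  forall d, f d = c0 * v d + \sum_(p <- l) p.1 * B d p.2.

Let affineD f g : affine f -> affine g -> affine (fun d => f d + g d).
Proof.
move=> [c [l fE]] [c' [l' gE]]; exists (c + c'), (l ++ l') => d.
by rewrite fE gE big_cat/=; ring.
Qed.

Let affineZ c f : affine f -> affine (fun d => c * f d).
Proof.
move=> [c0 [l fE]]; exists (c * c0), [seq (c * p.1, p.2) | p <- l] => d.
rewrite fE mulrDr mulrA; congr (_ + _); rewrite big_map mulr_sumr.
by apply: eq_bigr => p _; rewrite mulrA.
Qed.

Let affineB c b : affine (fun d => c * B d b).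
Proof. by exists 0, [:: (c, b)] => d; rewrite big_seq1 mul0r add0r. Qed.

Let affine0 : affine (fun=> 0).
Proof. by exists 0, [::] => d; rewrite big_nil mul0r add0r. Qed.

Let affine_sum (I : eqType) (r : seq I) (F : I -> T -> K) :
  (forall i, i \in r -> affine (F i)) -> affine (fun d => \sum_(i <- r) F i d).
Proof.
elim: r => [_|i r ih Fr].
  by under eq_fun do rewrite big_nil; exact: affine0.
under eq_fun do rewrite big_cons.
apply: affineD; first by apply: Fr; rewrite inE eqxx.
by apply: ih => j jr; apply: Fr; rewrite inE jr orbT.
Qed.

(** The coefficients [c0] and [l] do not depend on [d]: in the recursion [d] either stays in a
    shorter word or is contracted with an earlier letter, and symmetry of [B] then puts [d] in first
    position. Both multilinearity and the continuity estimates for Wick variables rest on this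
    form. *)
Lemma wick_slot s t : exists (c0 : K) (l : seq (K * T)),
  forall d, wick v B (s ++ d :: t) = c0 * v d + \sum_(p <- l) p.1 * B d p.2.
Proof.
rewrite -/(affine _).
have [m stm] := ubnP (size s + size t); elim: m s t stm => // m ih s t.
case: s => [|a s] /= stm.
  under eq_fun do rewrite wick_cons.
  exists (wick v B t), [seq (- wick v B p.2, p.1) | p <- splits t] => d.
  rewrite mulrC; congr (_ + _); rewrite big_map -sumrN.
  by apply: eq_bigr => p _ /=; rewrite mulNr mulrC.
under eq_fun do rewrite wick_cons splits_cat big_cat big_cons !big_map/=.
under eq_fun do rewrite -mulN1r.
apply: affineD; first by apply/affineZ/ih.
apply: affineZ; apply: affineD.
  apply: affine_sum => p /size_splits ps; apply: affineZ; apply: ih.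
  by move: stm; rewrite ps !addSn ltnS; exact: ltnW.
apply: affineD.
  by under eq_fun do rewrite mulrC Bsym; exact: affineB.
apply: affine_sum => p /size_splits ps; apply: affineZ; apply: ih.
by move: stm; rewrite ps addnS addSn ltnS; exact: ltnW.
Qed.

Lemma wick_linear s t (a : K) (x y z : T) :
  v z = a * v x + v y -> (forall b, B z b = a * B x b + B y b) ->
  wick v B (s ++ z :: t) = a * wick v B (s ++ x :: t) + wick v B (s ++ y :: t).
Proof.
move=> vz Bz; have [c0 [l E]] := wick_slot s t; rewrite !E vz.
under eq_bigr do rewrite Bz mulrDr mulrCA.
by rewrite big_split/= -mulr_sumr; ring.
Qed.

End OneSlot.

(* [partner i] is the only letter correlated with i: i itself for orthonormal
   letters, the conjugate letter in the complex case. *)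
Lemma wick_letters v B (I : eqType) (f : I -> T) (partner : I -> I)
    (s : seq I) (dom : pred I) (Q : seq I -> K) :
  (forall i j, dom i -> dom j -> B (f i) (f j) = (j == partner i)%:R) ->
  Q [::] = 1 ->
  (forall i (s : seq I), dom i -> all dom s -> Q (i :: s) =
     v (f i) * Q s - (count_mem (partner i) s)%:R * Q (rem (partner i) s)) ->
  (forall s t : seq I, perm_eq s t -> Q s = Q t) ->
  all dom s -> wick v B (map f s) = Q s.
Proof.
move=> BE Q0 QS Qperm; have [n sn] := ubnP (size s).
elim: n s sn => // n ih [|i s] //= sn /andP[di ds].
rewrite wick_cons QS// ih//; congr (_ - _).
(* Inside this section [splits] is tied to the letters [T]; [sp] is the same operation on words of
   indices. *)
pose sp := fix sp (s : seq I) := if s is a :: s' then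
  (a, s') :: [seq (p.1, a :: p.2) | p <- sp s'] else [::].
have -> : splits (map f s) = [seq (f p.1, map f p.2) | p <- sp s].
  elim: s {sn ds} => //= a s ->; congr (_ :: _).
  by rewrite -!map_comp.
have spP (u : seq I) p : p \in sp u -> perm_eq u (p.1 :: p.2).
  elim: u p => //= a u ihu p; rewrite inE => /predU1P[->//|].
  case/mapP => q /ihu qu ->/=.
  apply: (@perm_trans _ [:: a, q.1 & q.2]); first by rewrite perm_cons.
  by rewrite (perm_catCA [:: a] [:: q.1] q.2).
have mapsp (u : seq I) : map fst (sp u) = u.
  by elim: u => //= a u {2}<-; rewrite -map_comp.
rewrite big_map/=.
(* Only occurrences of the partner of [i] contribute, and since [Q] ignores order, removing any of
   them gives the same value; the sum is then a multiplicity. *)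
transitivity (\sum_(p <- sp s) (p.1 == partner i)%:R * Q (rem (partner i) s)).
  apply: eq_big_seq => p /spP sp_p.
  have dp : all dom (p.1 :: p.2) by rewrite -(perm_all _ sp_p).
  case/andP: (dp) => d1 d2; rewrite BE//; case: eqP => [<-|]; last by rewrite !mul0r.
  rewrite !mul1r ih//; last first.
    by move: sn; rewrite ltnS (perm_size sp_p)/=; apply: ltn_trans.
  apply: Qperm; rewrite -(perm_cons p.1); apply: perm_trans (perm_to_rem _).
    by rewrite perm_sym.
  by rewrite (perm_mem sp_p) inE eqxx.
rewrite -mulr_suml; congr (_ * _).
rewrite -{2}(mapsp s) -sum1_count big_map natr_sum [in RHS]big_mkcond/=.
by apply: eq_bigr => p _; case: eqP.
Qed.

End Wick.

Section WickHermite.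
Context {K : comPzRingType} {T : eqType}.
Variables (v : T -> K) (B : T -> T -> K) (N : nat).

(** Each orthonormal letter is its own partner. Prefixing [i] changes only the factor of index [i],
    so the Wick recursion reduces to the three-term recurrence of [h i]. *)
Lemma wick_hermite (f : nat -> T) (h : nat -> nat -> K) (s : seq nat) :
  (forall i j, B (f i) (f j) = (j == i)%:R) ->
  (forall k, h k 0%N = 1) ->
  (forall k n, h k n.+1 = v (f k) * h k n - n%:R * h k n.-1) ->
  all (fun i => i < N)%N s ->
  wick v B (map f s) = \prod_(k < N) h k (count_mem (k : nat) s).
Proof.
move=> BE h0 hS sN; pose Q s : K := \prod_(k < N) h k (count_mem (k : nat) s).
apply: (@wick_letters _ _ v B _ f id s (fun i => i < N)%N Q) => //.
- by rewrite /Q big1.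
- move=> i t iN _; pose i0 := Ordinal (iN : (i < N)%N).
  have neq (k : 'I_N) : k != i0 -> (i == k) = false.
    by move=> /negbTE; rewrite eq_sym -val_eqE.
  have E u : Q u = h i (count_mem i u) *
      \prod_(k < N | k != i0) h k (count_mem (k : nat) u).
    by rewrite /Q (bigD1 i0).
  rewrite !E /= eqxx add1n hS mulrBl !mulrA; congr (_ * _ - _ * _ * _).
  + by apply: eq_bigr => k ki; rewrite (neq k ki) ?add0n.
  + by rewrite count_mem_rem eqxx subn1.
  + by apply: eq_bigr => k ki; rewrite count_mem_rem (neq k ki) subn0.
- move=> t u /seq.permP tu; apply: eq_bigr => k _.
  by rewrite tu.
Qed.

(** The flag [true] marks conjugate letters. A letter is contracted only with its conjugate, which
    gives one recurrence of [g] for each kind of letter. *)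
Lemma wick_complex_hermite (f : nat * bool -> T) (g : nat -> nat -> nat -> K)
    (s : seq (nat * bool)) :
  (forall i j, B (f i) (f j) = (j == (i.1, ~~ i.2))%:R) ->
  (forall k, g k 0%N 0%N = 1) ->
  (forall k p q, g k p.+1 q = v (f (k, false)) * g k p q - q%:R * g k p q.-1) ->
  (forall k p q, g k p q.+1 = v (f (k, true)) * g k p q - p%:R * g k p.-1 q) ->
  all (fun i => i.1 < N)%N s ->
  wick v B (map f s) =
  \prod_(k < N) g k (count_mem (k : nat, false) s) (count_mem (k : nat, true) s).
Proof.
move=> BE g0 gl gr sN; pose Q s : K :=
  \prod_(k < N) g k (count_mem (k : nat, false) s) (count_mem (k : nat, true) s).
apply: (@wick_letters _ _ v B _ f (fun i => (i.1, ~~ i.2)) s (fun i => i.1 < N)%N Q) => //.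
- by rewrite /Q big1.
- move=> [i b] t iN _; pose i0 := Ordinal (iN : (i < N)%N).
  have neq (k : 'I_N) : k != i0 -> (i == k) = false.
    by move=> /negbTE; rewrite eq_sym -val_eqE.
  have E u : Q u = g i (count_mem (i, false) u) (count_mem (i, true) u) *
      \prod_(k < N | k != i0) g k (count_mem (k : nat, false) u) (count_mem (k : nat, true) u).
    by rewrite /Q (bigD1 i0).
  rewrite !E /= !xpair_eqE !eqxx/=.
  have E1 : \prod_(k < N | k != i0) g k (((i, b) == (k : nat, false)) + count_mem (k : nat, false) t)%N
     (((i, b) == (k : nat, true)) + count_mem (k : nat, true) t)%N =
     \prod_(k < N | k != i0) g k (count_mem (k : nat, false) t) (count_mem (k : nat, true) t).
    by apply: eq_bigr => k ki; rewrite !xpair_eqE (neq k ki) ?add0n.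
  have E2 : \prod_(k < N | k != i0) g k (count_mem (k : nat, false) (rem (i, ~~ b) t))
     (count_mem (k : nat, true) (rem (i, ~~ b) t)) =
     \prod_(k < N | k != i0) g k (count_mem (k : nat, false) t) (count_mem (k : nat, true) t).
    by apply: eq_bigr => k ki; rewrite !count_mem_rem !xpair_eqE (neq k ki) !subn0.
  rewrite E1 E2 !count_mem_rem !xpair_eqE !eqxx/= {E1 E2 E}.
  by case: (b) => /=; rewrite !add0n !add1n subn0 subn1 ?gl ?gr mulrBl !mulrA.
- move=> t u /seq.permP tu; apply: eq_bigr => k _.
  by rewrite !tu.
Qed.

End WickHermite.

(** * Integrals of squares *)

Section SquareIntegrals.
Context {disp : measure_display} {Om : measurableType disp} {R : realType}.
Variable P : probability Om R.
Implicit Types f g : Om -> R.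

Lemma L2normE f : (L2norm P f = (\int[P]_w (f w ^+ 2)%:E) `^ 2^-1)%E.
Proof.
rewrite /L2norm unlock; congr (_ `^ _)%E; apply: eq_integral => w _ /=.
by rewrite powR_mulrn// real_normK// num_real.
Qed.

Lemma L2norm_sqr_integral f (r : R) : L2norm P f = r%:E ->
  (\int[P]_w (f w ^+ 2)%:E = (r ^+ 2)%:E)%E.
Proof.
move=> fr; have r0 : 0 <= r by rewrite -lee_fin -fr Lnorm_ge0.
rewrite -(poweRe1 (x := \int[P]_w _)); last first.
  by apply: integral_ge0 => w _; rewrite lee_fin sqr_ge0.
by rewrite -(@mulVf R 2)// poweRrM -L2normE fr poweR_EFin powR_mulrn.
Qed.

Lemma le_L2norm_ae f g : measurable_fun [set: Om] f -> measurable_fun [set: Om] g ->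
  {ae P, forall w, `|f w| <= `|g w|} -> (L2norm P f <= L2norm P g)%E.
Proof.
move=> mf mg fg; rewrite !L2normE; apply: gt0_ler_poweR; first by rewrite invr_ge0.
- by rewrite in_itv/= leey andbT; apply: integral_ge0 => w _; rewrite lee_fin sqr_ge0.
- by rewrite in_itv/= leey andbT; apply: integral_ge0 => w _; rewrite lee_fin sqr_ge0.
apply: ae_ge0_le_integral => //.
- by move=> w _; rewrite lee_fin sqr_ge0.
- by apply/measurable_EFinP; exact: measurable_funX.
- by move=> w _; rewrite lee_fin sqr_ge0.
- by apply/measurable_EFinP; exact: measurable_funX.
apply: filterS fg => w fgw _ /=.
by rewrite lee_fin -(real_normK (num_real (f w))) -(real_normK (num_real (g w)))
  lerXn2r ?nnegrE.
Qed.

Lemma eq_L2norm_ae f g : measurable_fun [set: Om] f -> measurable_fun [set: Om] g ->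
  {ae P, forall w, f w = g w} -> L2norm P f = L2norm P g.
Proof.
move=> mf mg fg; apply/eqP; rewrite eq_le; apply/andP; split;
  apply: le_L2norm_ae => //; by apply: filterS fg => w ->.
Qed.

(** Taking eps = 1/(n+1), all bounds hold at once off a null set. The infimum [g] over n of u_n +
    1/(n+1) has integral at most 2/(n+1) for every n, hence is 0 almost everywhere. Only [g] is
    integrated, so [D] and [C] may be non-measurable. *)
Lemma ae_le0_of_small (D C : Om -> R) :
  (forall eps : R, 0 < eps -> exists u : Om -> R,
     [/\ measurable_fun [set: Om] u, forall w, 0 <= u w,
         (\int[P]_w (u w)%:E <= eps%:E)%E &
         {ae P, forall w, D w <= C w * (u w + eps)}]) ->
  {ae P, forall w, D w <= 0}.
Proof.
move=> h.
have /choice[u uP] : forall n : nat, exists u : Om -> R,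
   [/\ measurable_fun [set: Om] u, forall w, 0 <= u w,
         (\int[P]_w (u w)%:E <= (n.+1%:R^-1)%:E)%E &
         {ae P, forall w, D w <= C w * (u w + n.+1%:R^-1)}].
  by move=> n; apply: h; rewrite invr_gt0.
pose s w n := (u n w + n.+1%:R^-1)%:E.
pose g w := einfs (s w) 0%N.
have s0 w n : (0 <= s w n)%E.
  by have [_ u0 _ _] := uP n; rewrite lee_fin addr_ge0.
have g0 w : (0 <= g w)%E by apply: le_ereal_inf_tmp => _ [n _ <-]; exact: s0.
have ms n : measurable_fun [set: Om] (fun w => s w n).
  by have [mu _ _ _] := uP n; apply/measurable_EFinP; exact: measurable_funD.
have mg : measurable_fun [set: Om] g by exact: (measurable_fun_einfs ms).
have gs w n : (g w <= s w n)%E by apply: ereal_inf_lbound; exists n.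
have Ig n : (\int[P]_w g w <= (2 * n.+1%:R^-1)%:E)%E.
  apply: (@le_trans _ _ (\int[P]_w s w n)%E).
    by apply: ge0_le_integral.
  rewrite /s; under eq_integral do rewrite EFinD.
  have [mu u0 Iu _] := uP n.
  rewrite ge0_integralD//; [|by move=> w _; rewrite lee_fin|exact/measurable_EFinP].
  rewrite integral_cst//= probability_setT mule1 mulr_natl mulr2n EFinD.
  by rewrite leeD2r.
have Ig0 : (\int[P]_w `|g w| = 0)%E.
  under eq_integral do rewrite gee0_abs//.
  apply/eqP; rewrite eq_le integral_ge0 ?andbT//.
  apply/lee_addgt0Pr => e e0; rewrite add0e.
  pose k := Num.truncn (2 / e); apply: (le_trans (Ig k)); rewrite lee_fin.
  by rewrite ler_pdivrMr// -ler_pdivrMl// mulrC ltW// truncnS_gt.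
move/ae_eq_integral_abs : Ig0 => /(_ measurableT mg) gae.
have Dae : {ae P, forall w, forall n, D w <= C w * (u n w + n.+1%:R^-1)}.
  by apply: ae_foralln => n; have [_ _ _] := uP n.
move: gae; apply: filterS2 Dae => w Dw /(_ I) gw.
(* A single bound suffices when [C w <= 0]; otherwise [D w / C w] is a lower bound of the sequence,
   hence at most [g w = 0]. *)
have [C0|C0] := leP (C w) 0.
  have [_ u0 _ _] := uP 0%N.
  by apply: (le_trans (Dw 0%N)); rewrite mulr_le0_ge0// addr_ge0.
rewrite leNgt; apply/negP => D0.
suff : ((D w / C w)%:E <= g w)%E.
  by rewrite gw lee_fin leNgt divr_gt0.
apply: le_ereal_inf_tmp => _ [n _ <-]; rewrite lee_fin.
by rewrite ler_pdivrMr// mulrC.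
Qed.

End SquareIntegrals.

(** * Tensor powers and symmetrization *)

Section InnerProductFacts.
Context {K : numFieldType} {theta : K -> K} {V : lmodType K} (dot : {dot V for theta}).

Lemma dot_ge0 x : 0 <= dot x x.
Proof.
by have [->|/neq0_dnorm_gt0/ltW//] := eqVneq x 0; rewrite linear0l.
Qed.

Lemma dot_le0_eq0 x : dot x x <= 0 -> x = 0.
Proof.
by have [//|/(@neq0_dnorm_gt0 _ _ _ dot) h] := eqVneq x 0; rewrite lt_geF.
Qed.

Lemma dotN x : dot (- x) (- x) = dot x x.
Proof. by rewrite linearNl linearNr opprK. Qed.

Lemma dotB_le x y : dot (x - y) (x - y) <= 2 * (dot x x + dot y y).
Proof.
rewrite -subr_ge0 (_ : _ - _ = dot (x + y) (x + y)) ?dot_ge0//.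
by rewrite !linearDl !linearDr !linearNl !linearNr/=; ring.
Qed.

Lemma dotD_le x y : dot (x + y) (x + y) <= 2 * (dot x x + dot y y).
Proof. by have := dotB_le x (- y); rewrite opprK dotN. Qed.

Lemma closed_span_ind (A : set V) (Q : V -> Prop) :
  closed_span dot A = setT ->
  (forall x, A x -> Q x) -> Q 0 ->
  (forall a x y, Q x -> Q y -> Q (a *: x + y)) ->
  (forall x, (forall eps, 0 < eps -> exists2 y, Q y & dot (x - y) (x - y) < eps) -> Q x) ->
  forall x, Q x.
Proof.
move=> AT QA Q0 Qlin Qlim x.
have : closed_span dot A x by rewrite AT.
move=> Ax; apply: Qlim => eps /Ax[y [n [c [z [zA ->]]]]] yx.
exists (\sum_(i < n) c i *: z i) => //.
apply: (big_ind Q) => //.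
- by move=> u v Qu Qv; rewrite -[u]scale1r; exact: Qlin.
- by move=> i _; rewrite -[_ *: _]addr0; apply: Qlin => //; exact: QA.
Qed.

(** If [f x] were nonzero, the bound would keep every zero of [f] at a squared distance at least |f
    x|^2 / C from [x]. The positivity of the scalar [C] is itself read off from the bound, the order
    of [K] being only partial. *)
Lemma bounded_linear_eq0_closed (W : lmodType K) (dW : {dot W for theta}) (f : V -> W) (C : K) x :
  (forall y z, f (y - z) = f y - f z) ->
  (forall y, dW (f y) (f y) <= C * dot y y) ->
  (forall eps, 0 < eps -> exists2 y, f y = 0 & dot (x - y) (x - y) < eps) ->
  f x = 0.
Proof.
move=> fB fC xl; apply/eqP; apply: contraT => /(@neq0_dnorm_gt0 _ _ _ dW _) a0.
have le_a y : f y = 0 -> dW (f x) (f x) <= C * dot (x - y) (x - y).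
  by move=> fy; apply: le_trans (fC _); rewrite fB fy subr0.
have C0 : 0 < C.
  have [y /le_a fy _] := xl 1 ltr01.
  have : 0 < C * dot (x - y) (x - y) by apply: lt_le_trans fy.
  have [->|ny] := eqVneq (dot (x - y) (x - y)) 0; first by rewrite mulr0 ltxx.
  by rewrite pmulr_lgt0// lt_neqAle eq_sym ny dot_ge0.
have [|y /le_a fy xy] := xl (dW (f x) (f x) / C); first by rewrite divr_gt0.
have : C * dot (x - y) (x - y) < dW (f x) (f x) by rewrite mulrC -ltr_pdivlMr.
by rewrite le_gtF.
Qed.

End InnerProductFacts.

Section PureTensors.
Context {K : numFieldType} {theta : K -> K} {V : lmodType K} {dV : {dot V for theta}}.

Definition snoc n (x : 'I_n -> V) (y : V) (i : 'I_n.+1) : V :=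
  if unlift ord_max i is Some j then x j else y.

Lemma snoc_widen n (x : 'I_n -> V) y (i : 'I_n) : snoc x y (widen_ord (leqnSn n) i) = x i.
Proof.
have -> : widen_ord (leqnSn n) i = lift ord_max i by apply/val_inj; rewrite /= /bump leqNgt ltn_ord.
by rewrite /snoc liftK.
Qed.

Lemma snoc_max n (x : 'I_n -> V) y : snoc x y ord_max = y.
Proof. by rewrite /snoc unlift_none. Qed.

Section Tower.
Variable TT : tensor_tower dV.

Lemma pure_snoc n (x : 'I_n -> V) y : pure TT (snoc x y) = tmul TT n (pure TT x) y.
Proof.
by rewrite /= snoc_max (_ : (fun _ => _) = x)//; apply/funext => i; rewrite snoc_widen.
Qed.

Lemma dot_tmul n (F : tpow TT n) y :
  hdot (tpow TT n.+1) (tmul TT n F y) (tmul TT n F y) = hdot (tpow TT n) F F * dV y y.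
Proof. by have [-> _] := tmulP TT n. Qed.

(** With the last factor [y] frozen, [f] is a bounded map on the previous power, with constant
    multiplied by |y|^2; totality of elementary tensors does the rest. Since [symm] is prescribed
    only on pure tensors, its identities are all obtained this way. *)
Lemma pure_total n (W : lmodType K) (dW : {dot W for theta}) (f : tpow TT n -> W) (C : K) :
  (forall a F G, f (a *: F + G) = a *: f F + f G) ->
  (forall F, dW (f F) (f F) <= C * hdot (tpow TT n) F F) ->
  (forall x, f (pure TT x) = 0) -> forall F, f F = 0.
Proof.
elim: n f C => [|n ih] f C flin fC f0.
  move=> F; have [a ->] := tone_line F.
  have f00 : f 0 = 0.
    by have := flin (-1) 0 0; rewrite scaler0 addr0 scaleN1r addNr.
  rewrite -[_ *: _]addr0 flin f00 addr0.
  by have /= -> := f0 (fun=> 0); rewrite scaler0.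
have f00 : f 0 = 0.
  by have := flin (-1) 0 0; rewrite scaler0 addr0 scaleN1r addNr.
have fB y z : f (y - z) = f y - f z.
  by rewrite addrC -scaleN1r flin scaleN1r addrC.
have [_ total] := tmulP TT n.
apply: (closed_span_ind total) => //.
- move=> _ [[G y] _ <-] /=.
  apply: (ih (fun G => f (tmul TT n G y)) (C * dV y y)).
  + by move=> a F1 F2; rewrite linearPl flin.
  + by move=> F1; rewrite (le_trans (fC _))// dot_tmul mulrAC mulrA.
  + by move=> x; rewrite -pure_snoc f0.
- by move=> a x y fx fy; rewrite flin fx fy scaler0 addr0.
- move=> x; exact: (bounded_linear_eq0_closed fB fC).
Qed.

End Tower.

Section Symmetrization.
Variable TP : tensor_powers dV.

Lemma symm_pure_perm n (x : 'I_n -> V) (s : 'S_n) :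
  symm TP n (pure TP (x \o s)) = symm TP n (pure TP x).
Proof.
rewrite !symm_pure; congr (_ *: _).
rewrite [RHS](reindex_inj (mulIg s)); apply: eq_bigr => t _.
by congr pure; apply/funext => i; rewrite /= permM.
Qed.

Let fact_neq0 n : n`!%:R != 0 :> K.
Proof. by rewrite pnatr_eq0 -lt0n fact_gt0. Qed.

Lemma symm_avg n (W : lmodType K) (f : tpow TP n -> W) (x : 'I_n -> V) :
  (forall a F G, f (a *: F + G) = a *: f F + f G) ->
  (forall s : 'S_n, f (pure TP (x \o s)) = f (pure TP x)) ->
  f (symm TP n (pure TP x)) = f (pure TP x).
Proof.
move=> flin fs; have f0 : f 0 = 0.
  by have := flin (-1) 0 0; rewrite scaler0 addr0 scaleN1r addNr.
have fD : {morph f : F G / F + G}.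
  by move=> F G; rewrite -{1}[F]scale1r flin scale1r.
rewrite symm_pure -[_ *: _]addr0 flin f0 addr0 (big_morph f fD f0).
rewrite (eq_bigr (fun=> f (pure TP x))) => [|s _]; last exact: fs.
by rewrite sumr_const card_Sn -[X in _ *: X]scaler_nat scalerA mulVf// scale1r.
Qed.

Lemma symm_diff_bounded n : exists2 C : K, 0 <= C & forall F : tpow TP n,
  hdot (tpow TP n) (symm TP n F - F) (symm TP n F - F) <= C * hdot (tpow TP n) F F.
Proof.
have [C FC] := symm_bounded TP n.
(* A nonzero tensor is what forces [0 <= C]; in the trivial space [C] could be any scalar, and 0 is
   taken instead. *)
have [[F F0]|nF] := pselect (exists F : tpow TP n, F != 0); last first.
  exists 0 => // F; have [->|F0] := eqVneq F 0.
    by rewrite linear0 subr0 !linear0l.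
  by case: nF; exists F.
have C0 : 0 <= C.
  have h := @neq0_dnorm_gt0 _ _ _ (hdot (tpow TP n)) _ F0.
  by rewrite -(pmulr_lge0 _ h); apply: le_trans (FC F); exact: dot_ge0.
exists (2 * (C + 1)) => [|G]; first by rewrite mulr_ge0// addr_ge0.
apply: (le_trans (dotB_le _ _ _)); rewrite -mulrA ler_pM2l// mulrDl mul1r.
by rewrite lerD2r.
Qed.

Lemma symm_idem n (F : tpow TP n) : symm TP n (symm TP n F) = symm TP n F.
Proof.
have [C FC] := symm_bounded TP n; have [D D0 FD] := symm_diff_bounded n.
apply/eqP; rewrite -subr_eq0 -linearB; apply/eqP.
suff : forall G, symm TP n (symm TP n G - G) = 0 by [].
have C0 : 0 <= `|C| by [].
apply: (@pure_total TP n _ (hdot (tpow TP n)) _ (`|C| * D)).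
- by move=> a G G'; rewrite linearP /= opprD addrACA -scalerBr linearP.
- move=> G; set H := symm TP n G - G.
  apply: (@le_trans _ _ (`|C| * hdot (tpow TP n) H H)).
    have [->|H0] := eqVneq H 0; first by rewrite !linear0 ?linear0l ?mulr0.
    have h := @neq0_dnorm_gt0 _ _ _ (hdot (tpow TP n)) _ H0.
    have C1 : 0 <= C.
      by rewrite -(pmulr_lge0 _ h); apply: le_trans (FC _); exact: dot_ge0.
    by rewrite ger0_norm.
  by rewrite -mulrA ler_wpM2l ?FD.
- move=> x; rewrite linearB /=; apply/eqP; rewrite subr_eq0; apply/eqP.
  by apply: symm_avg => [a G G'|s]; rewrite ?linearP// symm_pure_perm.
Qed.

Lemma sympow_symm n (F : tpow TP n) : sympow (symm TP n F).
Proof. exact: symm_idem. Qed.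

(** A permutation of the first n factors extends to n+1 factors by fixing the last one, and the
    outer symmetrization absorbs it. So a recursion that symmetrizes at every step equals one final
    symmetrization. *)
Lemma symten_symm n (F : tpow TP n) y :
  symten (symm TP n F) y = symm TP n.+1 (tmul TP n F y).
Proof.
rewrite /symten.
have [C FC] := symm_bounded TP n.+1; have [D D0 FD] := symm_diff_bounded n.
apply/eqP; rewrite -subr_eq0 -linearB /= -linearBl /=; apply/eqP.
suff : forall G, symm TP n.+1 (tmul TP n (symm TP n G - G) y) = 0 by [].
apply: (@pure_total TP n _ (hdot (tpow TP n.+1)) _ (`|C| * (D * dV y y))).
- by move=> a G G'; rewrite linearP /= opprD addrACA -scalerBr linearPl linearP.
- move=> G; set H := tmul TP n _ y.
  apply: (@le_trans _ _ (`|C| * hdot (tpow TP n.+1) H H)).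
    have [->|H0] := eqVneq H 0; first by rewrite !linear0 ?linear0l ?mulr0.
    have h := @neq0_dnorm_gt0 _ _ _ (hdot (tpow TP n.+1)) _ H0.
    have C1 : 0 <= C.
      by rewrite -(pmulr_lge0 _ h); apply: le_trans (FC _); exact: dot_ge0.
    by rewrite ger0_norm.
  by rewrite -mulrA ler_wpM2l// /H dot_tmul mulrAC ler_wpM2r ?dot_ge0.
- move=> x; rewrite linearBl linearB /=; apply/eqP; rewrite subr_eq0; apply/eqP.
  apply: (@symm_avg n _ (fun G => symm TP n.+1 (tmul TP n G y))) => [a G G'|s].
    by rewrite linearPl linearP.
  rewrite -!pure_snoc -(symm_pure_perm (snoc x y) (lift_perm ord_max ord_max s)).
  congr (symm _ _ (pure _ _)); apply/funext => i /=.
  case: (unliftP ord_max i) => [j|] ->.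
    by rewrite lift_perm_lift /snoc !liftK.
  by rewrite lift_perm_id /snoc !unlift_none.
Qed.

Lemma tvec_symm y : tvec TP y = symm TP 1 (tmul TP 0 (tone TP) y).
Proof.
have e : tmul TP 0 (tone TP) y = pure TP (fun _ : 'I_1 => y) by [].
rewrite /tvec e symm_pure invr1 scale1r (eq_bigr (fun=> pure TP (fun _ : 'I_1 => y))) => [|s _]; last first.
  by [].
by rewrite sumr_const card_Sn.
Qed.

Lemma symm_pure_perm_eq n (f : nat -> V) (s t : seq nat) : size s = n -> perm_eq s t ->
  symm TP n (pure TP (fun i : 'I_n => f (nth 0%N s i))) =
  symm TP n (pure TP (fun i : 'I_n => f (nth 0%N t i))).
Proof.
move=> sn st; have tn : size t = n by rewrite -(perm_size st).
move: tn {sn} => <-; have /tuple_permP[r ->] : perm_eq s (in_tuple t) by [].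
rewrite -(symm_pure_perm (fun i => f (nth 0%N t i)) r).
congr (symm _ _ (pure _ _)); apply/funext => i /=.
by rewrite (nth_map i) ?size_enum_ord// nth_ord_enum (tnth_nth 0%N).
Qed.

End Symmetrization.
End PureTensors.

(** * Random multilinear maps on tensor powers *)

Section SquaredModulus.
Context {R : realType}.
Implicit Types z : R[i].

Definition sqmod z : R := complex.Re z ^+ 2 + complex.Im z ^+ 2.

Lemma sqmod_ge0 z : 0 <= sqmod z.
Proof. by rewrite addr_ge0 ?sqr_ge0. Qed.

Lemma sqmodM z1 z2 : sqmod (z1 * z2) = sqmod z1 * sqmod z2.
Proof. by case: z1 z2 => [a b] [c d]; rewrite /sqmod /=; ring. Qed.

Lemma sqmodD_le z1 z2 : sqmod (z1 + z2) <= 2 * (sqmod z1 + sqmod z2).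
Proof.
rewrite /sqmod -subr_ge0; case: z1 z2 => [a b] [c d] /=.
rewrite (_ : _ - _ = (a - c) ^+ 2 + (b - d) ^+ 2); last by ring.
by rewrite addr_ge0 ?sqr_ge0.
Qed.

Lemma sqmodN z : sqmod (- z) = sqmod z.
Proof. by case: z => a b; rewrite /sqmod /= !sqrrN. Qed.

Lemma sqmod_le0 z : sqmod z <= 0 -> z = 0.
Proof.
move=> z0; have : sqmod z == 0 by rewrite eq_le z0 sqmod_ge0.
rewrite /sqmod paddr_eq0 ?sqr_ge0// !sqrf_eq0 => /andP[/eqP a0 /eqP b0].
by apply/eqP; rewrite eq_complex a0 b0 !eqxx.
Qed.

Lemma sqmod_real (a : R) : sqmod a%:C = a ^+ 2.
Proof. by rewrite /sqmod/= expr0n addr0. Qed.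

Lemma normc_sqr z : Normc.normc z ^+ 2 = sqmod z.
Proof. by case: z => a b; rewrite /= sqr_sqrtr ?addr_ge0 ?sqr_ge0. Qed.

End SquaredModulus.

Lemma filterS4 (T : Type) (F : set_system T) {FF : Filter F}
    (P1 P2 P3 P4 Q : set T) : (forall x, P1 x -> P2 x -> P3 x -> P4 x -> Q x) ->
  F P1 -> F P2 -> F P3 -> F P4 -> F Q.
Proof.
move=> PQ F1 F2 F3 F4; apply: filterS3 F1 F2 (filterI F3 F4) => x p1 p2 [].
exact: PQ.
Qed.

Section RandomLinear.
Context {disp : measure_display} {Om : measurableType disp} {R : realType}.
Variable P : probability Om R.

Definition small_mean (eps : R) (u : Om -> R) :=
  [/\ measurable_fun [set: Om] u, forall w, 0 <= u w &
      (\int[P]_w (u w)%:E <= eps%:E)%E].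

Lemma smallD eps u eps' u' : small_mean eps u -> small_mean eps' u' ->
  small_mean (eps + eps') (fun w => u w + u' w).
Proof.
move=> [mu u0 Iu] [mu' u0' Iu']; split.
- exact: measurable_funD.
- by move=> w; rewrite addr_ge0.
- under eq_integral do rewrite EFinD.
  rewrite ge0_integralD//.
  + by rewrite EFinD leeD.
  + by move=> w _; rewrite lee_fin.
  + exact/measurable_EFinP.
  + by move=> w _; rewrite lee_fin.
  + exact/measurable_EFinP.
Qed.

Section Scalars.
Context {K : numFieldType} {theta : K -> K} (iota : {rmorphism K -> R[i]}).

Definition ae_linear (E : lmodType K) (g : E -> Om -> R[i]) := forall a x y,
  {ae P, forall w, g (a *: x + y) w = iota a * g x w + g y w}.

(* A quantitative form of continuity in probability: up to a random factor
   that does not depend on d, g d is bounded by a variable that is small in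
   mean when d is small. *)
Definition ae_continuous (E : lmodType K) (dE : {dot E for theta})
    (g : E -> Om -> R[i]) :=
  exists2 C : Om -> R, forall w, 0 <= C w & forall eps : R, 0 < eps ->
  exists2 delta : K, 0 < delta & forall d, dE d d < delta ->
  exists2 u, small_mean eps u & {ae P, forall w, sqmod (g d w) <= C w * (u w + eps)}.

Lemma ae_linear0 (E : lmodType K) (g : E -> Om -> R[i]) : ae_linear g ->
  {ae P, forall w, g 0 w = 0}.
Proof.
move=> /(_ (-1) 0 0); apply: filterS => w.
by rewrite scaler0 addr0 rmorphN rmorph1 mulN1r addNr.
Qed.

Lemma ae_linear_comp (E E' : lmodType K) (g : E -> Om -> R[i]) (h : E' -> E) :
  (forall a x y, h (a *: x + y) = a *: h x + h y) -> ae_linear g ->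
  ae_linear (g \o h).
Proof. by move=> hl gl a x y /=; rewrite hl; exact: gl. Qed.

Lemma ae_continuous_comp (E E' : lmodType K) (dE : {dot E for theta})
    (dE' : {dot E' for theta}) (g : E -> Om -> R[i]) (h : E' -> E) (c : K) :
  0 <= c -> (forall x, dE (h x) (h x) <= c * dE' x x) ->
  ae_continuous dE g -> ae_continuous dE' (g \o h).
Proof.
move=> c0 hc [C C0 gC]; exists C => // eps /gC[delta delta0 gd].
have c1 : 0 < c + 1 by rewrite ltr_wpDl.
exists (delta / (c + 1)); first by rewrite divr_gt0.
move=> d; rewrite ltr_pdivlMr// => dd; apply: gd; apply: le_lt_trans dd.
apply: (le_trans (hc d)); rewrite mulrC ler_wpM2l ?dot_ge0//.
by rewrite lerDl.
Qed.

Lemma ae_continuousB (E : lmodType K) (dE : {dot E for theta}) (g h : E -> Om -> R[i]) :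
  ae_continuous dE g -> ae_continuous dE h ->
  ae_continuous dE (fun d w => g d w - h d w).
Proof.
move=> [C C0 gC] [C' C0' hC]; exists (fun w => 2 * (C w + C' w)).
  by move=> w; rewrite mulr_ge0// addr_ge0.
move=> eps e0; have e20 : 0 < eps / 2 by rewrite divr_gt0.
have [de de0 gd] := gC _ e20; have [de' de0' hd] := hC _ e20.
(* This quantity lies below both [de] and [de'], which spares a comparison between them. *)
exists (de * de' / (de + de')); first by rewrite divr_gt0 ?addr_gt0 ?mulr_gt0.
move=> d; rewrite ltr_pdivlMr ?addr_gt0// => dd.
have d0 := dot_ge0 dE d.
have [|u us gu] := gd d.
  rewrite -(ltr_pM2r de0'); apply: le_lt_trans dd.
  by rewrite ler_wpM2l// lerDr ltW.
have [|v vs hv] := hd d.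
  rewrite -(ltr_pM2l de0); apply: le_lt_trans dd.
  by rewrite mulrC ler_wpM2l// lerDl ltW.
exists (fun w => u w + v w).
  by rewrite (splitr eps); exact: smallD.
apply: filterS2 gu hv => w gu hv.
apply: (le_trans (sqmodD_le _ _)); rewrite sqmodN -mulrA ler_pM2l//.
rewrite mulrDl lerD//.
  apply: (le_trans gu); rewrite ler_wpM2l// lerD//.
    by have [_ v0 _] := vs; rewrite lerDl.
  by lra.
apply: (le_trans hv); rewrite ler_wpM2l// lerD//.
  by have [_ u0 _] := us; rewrite lerDr.
by lra.
Qed.

(** If g and h agree at y, then g - h at x equals g - h at x - y almost everywhere, which is small
    when y is near x. Each eps involves one y only, so the exceptional null sets remain countable in
    number. *)
Lemma ae_eq_on_total (E : lmodType K) (dE : {dot E for theta}) (A : set E)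
    (g h : E -> Om -> R[i]) :
  closed_span dE A = setT ->
  ae_linear g -> ae_linear h -> ae_continuous dE g -> ae_continuous dE h ->
  (forall x, A x -> {ae P, forall w, g x w = h x w}) ->
  forall x, {ae P, forall w, g x w = h x w}.
Proof.
move=> AT gl hl gc hc ghA; apply: (closed_span_ind AT) => //.
- by have := ae_linear0 gl; apply: filterS2 (ae_linear0 hl) => w -> ->.
- move=> a x y Qx Qy; have := gl a x y; have := hl a x y.
  by apply: filterS4 Qx Qy => w -> -> -> ->.
have [C C0 gh] := ae_continuousB gc hc.
move=> x xlim.
suff : {ae P, forall w, sqmod (g x w - h x w) <= 0}.
  by apply: filterS => w /sqmod_le0/eqP; rewrite subr_eq0 => /eqP.
apply: (@ae_le0_of_small _ _ _ _ _ C) => eps e0.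
have [delta /xlim[y Qy yd] /(_ _ yd)[u [mu u0 Iu] ghu]] := gh _ e0.
exists u; split => //.
have e : x = 1 *: (x - y) + y by rewrite scale1r subrK.
have := gl 1 (x - y) y; have := hl 1 (x - y) y; rewrite -e.
move: Qy ghu; apply: filterS4 => w gy hgu ; rewrite rmorph1 !mul1r => -> ->.
by rewrite gy opprD addrACA subrr addr0.
Qed.

Section PureTensors.
Context {V : lmodType K} {dV : {dot V for theta}} (TT : tensor_tower dV).
Local Notation pure_of n x := (pure TT (fun i : 'I_n => x (i : nat))).

Lemma eq_pure_of n (x y : nat -> V) : (forall i, (i < n)%N -> x i = y i) ->
  pure_of n x = pure_of n y.
Proof. by move=> xy; congr pure; apply/funext => i; rewrite xy. Qed.

Lemma pure_ofS n (x : nat -> V) : pure_of n.+1 x = tmul TT n (pure_of n x) (x n).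
Proof. by []. Qed.

Definition multi_ae_linear (phi : seq V -> Om -> R[i]) :=
  forall s t, ae_linear (fun d => phi (s ++ d :: t)).

Definition multi_ae_continuous (phi : seq V -> Om -> R[i]) :=
  forall s t, ae_continuous dV (fun d => phi (s ++ d :: t)).

(** One slot at a time: with the last vector frozen in [A], induction frees the first n slots; with
    these frozen, [ae_eq_on_total] frees the last one. *)
Lemma ae_eq_on_pure_tensors (A : set V) n (L : tpow TT n -> Om -> R[i])
    (phi : seq V -> Om -> R[i]) :
  closed_span dV A = setT ->
  ae_linear L -> ae_continuous (hdot (tpow TT n)) L ->
  multi_ae_linear phi -> multi_ae_continuous phi ->
  (forall x : nat -> V, (forall i, (i < n)%N -> A (x i)) ->
     {ae P, forall w, L (pure_of n x) w = phi (mkseq x n) w}) ->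
  forall x : nat -> V, {ae P, forall w, L (pure_of n x) w = phi (mkseq x n) w}.
Proof.
move=> AT; elim: n L phi => [|n ih] L phi Ll Lc pl pc LA x.
  exact: LA.
have step r : A r -> {ae P, forall w, L (tmul TT n (pure_of n x) r) w =
    phi (mkseq x n ++ [:: r]) w}.
  move=> Ar; move: x.
  apply: (ih (fun F => L (tmul TT n F r)) (fun s => phi (s ++ [:: r]))).
  - by apply: (ae_linear_comp _ Ll) => a F G; rewrite linearPl.
  - apply: (@ae_continuous_comp _ _ _ _ _ (fun F => tmul TT n F r) (dV r r)) Lc.
      exact: dot_ge0.
    by move=> F; rewrite dot_tmul mulrC.
  - by move=> s t; have := pl s (t ++ [:: r]); under eq_fun do rewrite -cat_cons catA.
  - by move=> s t; have := pc s (t ++ [:: r]); under eq_fun do rewrite -cat_cons catA.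
  - move=> x Ax; pose y i := if (i < n)%N then x i else r.
    have yn i : (i < n)%N -> y i = x i by rewrite /y => ->.
    have yr : y n = r by rewrite /y ltnn.
    have := LA y; rewrite pure_ofS (eq_pure_of yn) yr mkseqS yr -cats1 => LAy.
    have -> : mkseq x n = mkseq y n.
      by apply/eq_in_map => i; rewrite mem_iota => /yn.
    by apply: LAy => i _; rewrite /y; case: ifPn => // /Ax.
rewrite pure_ofS mkseqS -cats1.
apply: (ae_eq_on_total AT (g := fun d => L (tmul TT n (pure_of n x) d))
  (h := fun d => phi (mkseq x n ++ [:: d]))) => //.
- by apply: (ae_linear_comp _ Ll) => a y z; rewrite linearPr.
- apply: (@ae_continuous_comp _ _ _ _ _ (tmul TT n (pure_of n x))
    (hdot (tpow TT n) (pure_of n x) (pure_of n x))) Lc.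
    exact: dot_ge0.
  by move=> d; rewrite dot_tmul.
Qed.

End PureTensors.
End Scalars.
End RandomLinear.

(** * Complex kernels *)

Section ComplexTensors.
Context {disp : measure_display} {Om : measurableType disp} {R : realType}.
Variable P : probability Om R.
Context {V : lmodType R} {dV : {dot V for @idfun R}} (TT : tensor_tower dV).
Local Notation VC := (complexification V).

(* Real and imaginary parts of x_0 (x) ... (x) x_(n-1), for x_i in VC. *)
Fixpoint complex_pure n (x : nat -> VC) : tpow TT n * tpow TT n :=
  match n with
  | 0 => (tone TT, 0)
  | n'.+1 => let uv := complex_pure n' x in
      (tmul TT n' uv.1 (x n').1 - tmul TT n' uv.2 (x n').2,
       tmul TT n' uv.1 (x n').2 + tmul TT n' uv.2 (x n').1)
  end.

Definition real_embedding (x : V) : VC := (x, 0).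

Lemma complexification_decomp (x : VC) :
  x = 'i%C *: real_embedding x.2 + real_embedding x.1.
Proof.
case: x => a b; rewrite /GRing.scale/= /complexification_scale/=.
by congr pair; rewrite /= ?scale0r ?scale1r ?scaler0 ?subr0 ?addr0 ?add0r.
Qed.

(** Agreement on real vectors determines a complex multilinear [phi]: each letter is split as i
    times its imaginary part plus its real part, and [complex_pure] performs the same expansion on
    tensors. *)
Lemma ae_eq_complex_pure n (L : tpow TT n -> Om -> R[i]) (phi : seq VC -> Om -> R[i]) :
  ae_linear P (real_complex R) L -> multi_ae_linear P idfun phi ->
  (forall x : nat -> V, {ae P, forall w, L (pure TT (fun i : 'I_n => x i)) w =
     phi (mkseq (real_embedding \o x) n) w}) ->
  forall x : nat -> VC, {ae P, forall w,
    L (complex_pure n x).1 w + 'i%C * L (complex_pure n x).2 w = phi (mkseq x n) w}.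
Proof.
elim: n L phi => [|n ih] L phi Ll pl LE x.
  have := ae_linear0 Ll; apply: filterS2 (LE (fun=> 0)) => w /= -> ->.
  by rewrite mulr0 addr0.
have step r : {ae P, forall w, L (tmul TT n (complex_pure n x).1 r) w +
    'i%C * L (tmul TT n (complex_pure n x).2 r) w =
    phi (mkseq x n ++ [:: real_embedding r]) w}.
  apply: (ih (fun F => L (tmul TT n F r)) (fun s => phi (s ++ [:: real_embedding r]))).
  - by apply: (ae_linear_comp _ Ll) => a F G; rewrite linearPl.
  - move=> s t; have := pl s (t ++ [:: real_embedding r]).
    by under eq_fun do rewrite -cat_cons catA.
  - move=> y; pose z i := if (i < n)%N then y i else r.
    have yn i : (i < n)%N -> z i = y i by rewrite /z => ->.
    have zr : z n = r by rewrite /z ltnn.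
    have := LE z; rewrite pure_ofS (eq_pure_of _ yn) zr mkseqS -cats1 /= zr.
    have -> // : mkseq (real_embedding \o z) n = mkseq (real_embedding \o y) n.
    by apply/eq_in_map => i; rewrite mem_iota => /yn /= ->.
set U := (complex_pure n x).1 in step *; set W := (complex_pure n x).2 in step *.
have E1 : tmul TT n U (x n).1 - tmul TT n W (x n).2 =
    (-1) *: tmul TT n W (x n).2 + tmul TT n U (x n).1 by rewrite scaleN1r addrC.
have E2 : tmul TT n U (x n).2 + tmul TT n W (x n).1 =
    1 *: tmul TT n U (x n).2 + tmul TT n W (x n).1 by rewrite scale1r.
have E3 : phi (mkseq x n.+1) = phi (mkseq x n ++
    [:: 'i%C *: real_embedding (x n).2 + real_embedding (x n).1]).
  by rewrite mkseqS -cats1 -complexification_decomp.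
rewrite E3 [complex_pure n.+1 x]/= -/U -/W [(_, _).1]/= [(_, _).2]/= E1 E2.
have h1 := Ll 1 (tmul TT n U (x n).2) (tmul TT n W (x n).1).
have h2 := Ll (-1) (tmul TT n W (x n).2) (tmul TT n U (x n).1).
have h3 := pl (mkseq x n) [::] 'i%C (real_embedding (x n).2) (real_embedding (x n).1).
apply: filterS4 (filterI (step (x n).1) (step (x n).2)) h1 h2 h3 =>
  w [s1 s2] -> -> ->; rewrite -s1 -s2 rmorphN rmorph1.
have /(congr1 (fun z => z * L (tmul TT n W (x n).2) w)) := sqr_i R.
by rewrite expr2 => ii; rewrite /= [in RHS]mulrDr mulrA ii; ring.
Qed.

End ComplexTensors.

Section ExplicitKernels.
Context {R : realType} {V : lmodType R} {dV : {dot V for @idfun R}}.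
Variable TP : tensor_powers (sum_dot dV dV).
Variable e : nat -> complexification V.

(** The letter u_{1,0} + i v_{1,0}, conjugated for the indices [j]. The conjugate letters come first
    because [uv] builds the pair at (0, q) before adding the indices [k]. *)
Definition kernel_letter (q : nat) (j k : nat -> nat) (i : nat) :
    complexification (V * V)%type :=
  if (i < q)%N then (u01 e (j i), v01 e (j i))
  else (u10 e (k (i - q)%N), v10 e (k (i - q)%N)).

Let uv_stepE n (x : nat -> complexification (V * V)%type) :
  uv_step ((symm TP n (complex_pure TP n x).1), (symm TP n (complex_pure TP n x).2))
    (x n).1 (x n).2 =
  (symm TP n.+1 (complex_pure TP n.+1 x).1, symm TP n.+1 (complex_pure TP n.+1 x).2).
Proof.
case: n => [|n] /=; first by rewrite !linear0l subr0 addr0 !tvec_symm.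
by rewrite !symten_symm -linearB -linearD.
Qed.

Lemma uvE p q (j k : nat -> nat) : (0 < p + q)%N ->
  uv TP e (fun i : 'I_p => k i) (fun i : 'I_q => j i) =
  (symm TP (p + q) (complex_pure TP (p + q) (kernel_letter q j k)).1,
   symm TP (p + q) (complex_pure TP (p + q) (kernel_letter q j k)).2).
Proof.
(* The cut-off [r] is kept apart from the induction variable [m], so that [kernel_letter] stays the
   same while [m] grows. *)
have h0 m r : (m <= r)%N -> (0 < m)%N -> uv0 TP e (fun i : 'I_m => j i) =
   (symm TP m (complex_pure TP m (kernel_letter r j k)).1,
    symm TP m (complex_pure TP m (kernel_letter r j k)).2).
  elim: m => // m ih mr _; rewrite -uv_stepE /= /kernel_letter mr.
  case: m ih mr => [|m] ih mr; first by [].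
  by rewrite -(ih (ltnW mr)).
elim: p => [|p ih] pq; first exact: h0.
rewrite [(p.+1 + q)%N]/= -uv_stepE.
have -> : kernel_letter q j k (p + q) = (u10 e (k p), v10 e (k p)).
  by rewrite /kernel_letter ltnNge leq_addl addnK.
(* At p = q = 0 the induction hypothesis says nothing, since its premise [0 < p + q] fails; but
   [uv_step] at 0 ignores its pair. *)
have [pq0|pq0] := posnP (p + q)%N; last by rewrite -ih.
move: pq0 ih pq => /eqP; rewrite addn_eq0 => /andP[/eqP p0 /eqP q0].
by subst p q.
Qed.

End ExplicitKernels.

(** * Isonormal processes and Wick variables *)

Section RealInnerProduct.
Context {R : realType} {V : lmodType R} (dV : {dot V for @idfun R}).

Lemma real_dotC x y : dV x y = dV y x.
Proof. by rewrite (hermC dV) expr0 mul1r. Qed.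

Lemma real_CauchySchwarz x y : dV x y ^+ 2 <= dV x x * dV y y.
Proof.
have [->|y0] := eqVneq y 0; first by rewrite !linear0r expr0n ?linear0r ?mulr0.
have yy := @neq0_dnorm_gt0 _ _ _ dV _ y0.
have := dot_ge0 dV (x - (dV x y / dV y y) *: y).
rewrite !linearBl !linearBr !linearZl_LR !linearZr_LR/= (real_dotC y x).
set a := dV x x; set b := dV x y; set c := dV y y in yy *.
have c0 : c != 0 by rewrite gt_eqF.
rewrite (_ : _ - _ = a - b ^+ 2 / c); last by rewrite /GRing.scale/=; field.
by rewrite subr_ge0 ler_pdivrMr.
Qed.

End RealInnerProduct.

Section IsonormalFacts.
Context {disp : measure_display} {Om : measurableType disp} {R : realType}.
Variable P : probability Om R.
Context {V : lmodType R} (dV : {dot V for @idfun R}) (X : V -> {RV P >-> R}).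
Hypothesis isoX : isonormal dV X.

Lemma isonormal_sqr h : (\int[P]_w (X h w ^+ 2)%:E = (dV h h)%:E)%E.
Proof. by have [_ /(_ h h)] := isoX; rewrite unlock. Qed.

Let integrable_mul h g : P.-integrable [set: Om] (fun w => (X h w * X g w)%:E).
Proof.
have sq k : P.-integrable [set: Om] (fun w => (X k w ^+ 2)%:E).
  apply/integrableP; split; first by apply/measurable_EFinP; exact: measurable_funX.
  under eq_integral do rewrite gee0_abs ?lee_fin ?sqr_ge0//.
  by rewrite isonormal_sqr ltry.
apply: (le_integrable _ _ _ (integrableD measurableT (sq h) (sq g))) => //.
  by apply/measurable_EFinP; exact: measurable_funM.
move=> w _ /=; rewrite lee_fin normrM (@ger0_norm _ (_ + _)) ?addr_ge0 ?sqr_ge0//.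
rewrite -(real_normK (num_real (X h w))) -(real_normK (num_real (X g w))).
by set a := `|X h w|; set b := `|X g w|; nra.
Qed.

Let integral_quadratic (s : seq (R * V * V)) :
  (\int[P]_w (\sum_(t <- s) t.1.1 * (X t.1.2 w * X t.2 w))%:E =
   (\sum_(t <- s) t.1.1 * dV t.1.2 t.2)%:E)%E.
Proof.
under eq_integral do rewrite -sumEFin.
rewrite integral_sum//; last first.
  move=> t; under eq_fun do rewrite EFinM.
  exact: integrableZl.
rewrite -sumEFin; apply: eq_bigr => t _.
under eq_integral do rewrite EFinM.
rewrite integralZl//; have [_ /(_ t.1.2 t.2)] := isoX.
by rewrite unlock => ->.
Qed.

(** The second moment of the defect expands by the covariance rule into the squared norm of
    [z - (a *: h + g)], which is 0. *)
Lemma isonormal_ae_linear a h g :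
  {ae P, forall w, X (a *: h + g) w = a * X h w + X g w}.
Proof.
set z := a *: h + g.
pose D w := X z w - (a * X h w + X g w).
have mD : measurable_fun [set: Om] D.
  apply: measurable_funB => //; apply: measurable_funD => //.
  exact: measurable_funM.
have ID : (\int[P]_w (D w ^+ 2)%:E = 0)%E.
  (* The six monomials of the squared defect, each as a coefficient and two vectors. *)
  pose s := [:: (1, z, z); (a ^+ 2, h, h); (1, g, g); (- 2 * a, z, h); (- 2, z, g); (2 * a, h, g)].
  rewrite (eq_integral (fun w => (\sum_(t <- s) t.1.1 * (X t.1.2 w * X t.2 w))%:E)); last first.
    by move=> w _; congr EFin; rewrite !big_cons big_nil /D/=; ring.
  rewrite integral_quadratic !big_cons big_nil /= /z.
  rewrite !linearDl !linearDr !linearZl_LR !linearZr_LR/= (real_dotC dV g h).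
  by rewrite /GRing.scale/=; congr EFin; ring.
have : (\int[P]_w `|(D w ^+ 2)%:E| = 0)%E.
  by rewrite -ID; apply: eq_integral => w _; rewrite gee0_abs// lee_fin sqr_ge0.
move/ae_eq_integral_abs => /(_ measurableT).
have mD2 : measurable_fun [set: Om] (fun w => (D w ^+ 2)%:E).
  by apply/measurable_EFinP; exact: measurable_funX.
move=> /(_ mD2); apply: filterS => w /(_ I) /eqP; rewrite /= eqe sqrf_eq0 subr_eq0.
by move=> /eqP.
Qed.

End IsonormalFacts.

(** * Bilinear covariance and Wick variables of [W] *)

Section Covariance.
Context {R : realType} {V : lmodType R} (dV : {dot V for @idfun R}).
Local Notation VC := (complexification V).
Implicit Types x y z : VC.

(** Undoing the conjugation of [cdot] gives the complex bilinear extension of the real inner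
    product: the expectation of a product of two complex samples, neither of them conjugated. *)
Definition covariance_form x y : R[i] := cdot dV x (vconj y).
Definition real_sqnorm x : R := dV x.1 x.1 + dV x.2 x.2.

Lemma covariance_form_sym x y : covariance_form x y = covariance_form y x.
Proof.
rewrite /covariance_form /cdot /= !linearNr/= (real_dotC dV y.1 x.1)
  (real_dotC dV y.2 x.2) (real_dotC dV y.1 x.2) (real_dotC dV y.2 x.1).
by congr (_ +i* _); ring.
Qed.

Lemma covariance_form_linear a x y z :
  covariance_form (a *: x + y) z = a * covariance_form x z + covariance_form y z.
Proof. by rewrite /covariance_form linearDl linearZl_LR. Qed.

Lemma real_sqnorm_ge0 x : 0 <= real_sqnorm x.
Proof. by rewrite addr_ge0 ?dot_ge0. Qed.

Lemma covariance_form_bound x y :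
  sqmod (covariance_form x y) <= 4 * real_sqnorm x * real_sqnorm y.
Proof.
rewrite /sqmod /covariance_form /cdot /real_sqnorm /= !linearNr/=.
have h11 := real_CauchySchwarz dV x.1 y.1; have h12 := real_CauchySchwarz dV x.1 y.2.
have h21 := real_CauchySchwarz dV x.2 y.1; have h22 := real_CauchySchwarz dV x.2 y.2.
have x1 := dot_ge0 dV x.1; have x2 := dot_ge0 dV x.2.
have y1 := dot_ge0 dV y.1; have y2 := dot_ge0 dV y.2.
move: (dV x.1 y.1) (dV x.1 y.2) (dV x.2 y.1) (dV x.2 y.2) h11 h12 h21 h22 => a b c d.
move: (dV x.1 x.1) (dV x.2 x.2) (dV y.1 y.1) (dV y.2 y.2) x1 x2 y1 y2 => p q r s.
move=> p0 q0 r0 s0 ha hb hc hd.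
have := mulr_ge0 p0 r0; have := mulr_ge0 p0 s0; have := mulr_ge0 q0 r0.
have := mulr_ge0 q0 s0; have := sqr_ge0 (a + d); have := sqr_ge0 (b - c).
by nra.
Qed.

Lemma vconj_linear (a : R[i]) x y : vconj (a *: x + y) = (a^*)%C *: vconj x + vconj y.
Proof.
case: a x y => [a a'] [x1 x2] [y1 y2].
rewrite /vconj/= /GRing.scale/= /complexification_scale/=.
by congr pair; rewrite /= ?scalerN ?scaleNr ?opprK// !opprD.
Qed.

Lemma vconjK x : vconj (vconj x) = x.
Proof. by case: x => a b; rewrite /vconj/= opprK. Qed.

End Covariance.

Section WickVariables.
Context {disp : measure_display} {Om : measurableType disp} {R : realType}.
Variable P : probability Om R.
Context {V : lmodType R} (dV : {dot V for @idfun R}) (X Y : V -> {RV P >-> R}).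
Hypotheses (isoX : isonormal dV X) (isoY : isonormal dV Y).
Local Notation GC := (complexification (V * V)%type).
Local Notation dG := (sum_dot dV dV).

Definition sample (x : GC) (w : Om) : R[i] :=
  W_process X Y x.1 w +i* W_process X Y x.2 w.

Lemma W_process_ae_linear a h g :
  {ae P, forall w, W_process X Y (a *: h + g) w = a * W_process X Y h w + W_process X Y g w}.
Proof.
have hx := isonormal_ae_linear isoX a h.1 g.1.
have hy := isonormal_ae_linear isoY a h.2 g.2.
apply: filterS2 hx hy => w; rewrite /W_process /= => -> ->; ring.
Qed.

Lemma sample_ae_linear : ae_linear P idfun sample.
Proof.
move=> [a a'] x y.
have h1 := W_process_ae_linear a x.1 (- a' *: x.2 + y.1).
have h2 := W_process_ae_linear (- a') x.2 y.1.
have h3 := W_process_ae_linear a x.2 (a' *: x.1 + y.2).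
have h4 := W_process_ae_linear a' x.1 y.2.
have e1 : (((a +i* a') *: x + y : GC)).1 = a *: x.1 + (- a' *: x.2 + y.1).
  by rewrite /= scaleNr addrA.
have e2 : (((a +i* a') *: x + y : GC)).2 = a *: x.2 + (a' *: x.1 + y.2).
  by rewrite /= addrA.
apply: filterS4 h1 h2 h3 h4 => w h1 h2 h3 h4.
rewrite /sample e1 e2 h1 h2 h3 h4; simpc.
by congr (_ +i* _); ring.
Qed.

Lemma sample_small x :
  exists2 u, small_mean P (4 * real_sqnorm dG x) u & forall w, sqmod (sample x w) <= 2 * u w.
Proof.
exists (fun w => (X x.1.1 w ^+ 2 + Y x.1.2 w ^+ 2) + (X x.2.1 w ^+ 2 + Y x.2.2 w ^+ 2)).
  have sq (Z : V -> {RV P >-> R}) (isoZ : isonormal dV Z) h :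
      small_mean P (dV h h) (fun w => Z h w ^+ 2).
    split; [exact: measurable_funX|by move=> w; exact: sqr_ge0|].
    by rewrite (isonormal_sqr isoZ).
  have [mu u0 Iu] := smallD (smallD (sq _ isoX x.1.1) (sq _ isoY x.1.2))
    (smallD (sq _ isoX x.2.1) (sq _ isoY x.2.2)).
  split => //; apply: (le_trans Iu); rewrite lee_fin.
  have := real_sqnorm_ge0 dG x; rewrite /real_sqnorm /= /sum_dot.
  by set r := (_ + _ + _); lra.
move=> w; rewrite /sqmod /sample /W_process /=.
move: (X x.1.1 w) (Y x.1.2 w) (X x.2.1 w) (Y x.2.2 w) => a b c d.
by have := sqr_ge0 (a - b); have := sqr_ge0 (c - d); nra.
Qed.

Definition wick_variable (s : seq GC) (w : Om) : R[i] :=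
  wick (fun x => sample x w) (covariance_form dG) s.

Lemma wick_variable_multi_ae_linear : multi_ae_linear P idfun wick_variable.
Proof.
move=> s t a x y; apply: filterS (sample_ae_linear a x y) => w xyw.
apply: wick_linear => //; first exact: covariance_form_sym.
by move=> b; exact: covariance_form_linear.
Qed.

(** For fixed [w] the coefficients of [wick_slot] are constants determined by the other letters, so
    Cauchy-Schwarz for the covariances is enough. [C] is chosen for each [w] separately and carries
    no measurability. *)
Lemma wick_variable_slot_bound s t : exists2 C : Om -> R, forall w, 0 <= C w &
  forall d w, sqmod (wick_variable (s ++ d :: t) w) <=
    C w * (sqmod (sample d w) + real_sqnorm dG d).
Proof.
suff /choice[C CP] : forall w, exists C : R, 0 <= C /\ forall d,
    sqmod (wick_variable (s ++ d :: t) w) <= C * (sqmod (sample d w) + real_sqnorm dG d).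
  by exists C => [w|d w]; have [] := CP w.
move=> w; have [c0 [l E]] := wick_slot (fun x => sample x w)
  (covariance_form_sym dG) s t.
have [M M0 HM] : exists2 M : R, 0 <= M & forall d,
    sqmod (\sum_(p <- l) p.1 * covariance_form dG d p.2) <= M * real_sqnorm dG d.
  elim: l {E} => [|[c y] l [M M0 ihl]].
    by exists 0 => // d; rewrite big_nil mul0r /sqmod /= expr0n addr0.
  exists (2 * (sqmod c * (4 * real_sqnorm dG y) + M)) => [|d].
    by rewrite mulr_ge0// addr_ge0// mulr_ge0 ?sqmod_ge0// mulr_ge0// real_sqnorm_ge0.
  rewrite big_cons /=; apply: (le_trans (sqmodD_le _ _)).
  rewrite -[leRHS]mulrA ler_pM2l// mulrDl lerD// sqmodM -mulrA ler_wpM2l ?sqmod_ge0//.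
  by rewrite mulrAC; exact: covariance_form_bound.
exists (2 * (sqmod c0 + M)); split; first by rewrite mulr_ge0// addr_ge0 ?sqmod_ge0.
move=> d; rewrite /wick_variable E; apply: (le_trans (sqmodD_le _ _)).
rewrite sqmodM -mulrA ler_pM2l//; have := HM d.
have := sqmod_ge0 c0; have := sqmod_ge0 (sample d w); have := real_sqnorm_ge0 dG d.
move: (sqmod c0) (sqmod (sample d w)) (real_sqnorm dG d) (sqmod _) => a b c e c0' b0 a0 h.
by nra.
Qed.

Lemma wick_variable_comp_ae_linear {K : numFieldType} (iota : {rmorphism K -> R[i]})
    (E : lmodType K) (l : E -> GC) (pre post : seq GC) :
  (forall a x y, l (a *: x + y) = iota a *: l x + l y) ->
  multi_ae_linear P iota (fun s => wick_variable (pre ++ map l s ++ post)).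
Proof.
move=> ll s t a x y; rewrite !map_cat /= -!catA !(catA pre) !cat_cons ll.
exact: wick_variable_multi_ae_linear.
Qed.

Lemma wick_variable_comp_ae_continuous {K : numFieldType} {theta : K -> K}
    (E : lmodType K) (dE : {dot E for theta}) (l : E -> GC) (pre post : seq GC) :
  (forall eps : R, 0 < eps -> exists2 delta : K, 0 < delta &
     forall d, dE d d < delta -> real_sqnorm dG (l d) < eps) ->
  multi_ae_continuous P (dV := dE) (fun s => wick_variable (pre ++ map l s ++ post)).
Proof.
move=> lc s t.
have [C C0 CP] := wick_variable_slot_bound (pre ++ map l s) (map l t ++ post).
exists (fun w => 2 * C w) => [w|eps e0]; first by rewrite mulr_ge0.
(* The 4 offsets the constant in [sample_small]. *)
have [|delta d0 dl] := lc (eps / 4); first by rewrite divr_gt0.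
exists delta => // d /dl ld; have [u us xu] := sample_small (l d).
exists u.
  have [mu u0 Iu] := us; split => //; apply: (le_trans Iu).
  by rewrite lee_fin mulrC -ler_pdivlMr// ltW.
apply/nearW => w; rewrite map_cat/= -catA catA cat_cons.
apply: (le_trans (CP _ _)); rewrite -mulrA mulrCA ler_wpM2l//.
have [_ u0 _] := us; have := xu w; have := u0 w.
by move: (sqmod _) (u w) => a b b0 ab; lra.
Qed.

End WickVariables.

Section ClosedSpan.
Context {K : numFieldType} {theta : K -> K} {V : lmodType K} (dot : {dot V for theta}).

Lemma sub_closed_span (A : set V) : A `<=` closed_span dot A.
Proof.
move=> x Ax eps e0; exists x; last by rewrite subrr linear0l.
by exists 1%N, (fun=> 1), (fun=> x); split => //; rewrite big_ord1 scale1r.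
Qed.

End ClosedSpan.

(** * Conjugation, and the embedding under which [Z] becomes a sample of [W] *)

Section Conjugation.
Context {R : realType} {V : lmodType R} (dV : {dot V for @idfun R}).
Local Notation VC := (complexification V).

Lemma cdot_vconj (x y : VC) : cdot dV (vconj x) (vconj y) = (cdot dV x y)^*%C.
Proof.
rewrite /cdot /= !linearNl !linearNr/= !opprK /=.
by congr (_ +i* _); ring.
Qed.

Lemma vconj_total (A : set VC) : closed_span (cdot dV) A = setT ->
  closed_span (cdot dV) (@vconj R V @` A) = setT.
Proof.
move=> AT; apply/seteqP; split => // x _ eps e0.
have : closed_span (cdot dV) A (vconj x) by rewrite AT.
case/(_ _ e0) => _ [n [c [z [zA ->]]]] yx.
have vconjD : {morph @vconj R V : u v / u + v}.
  by move=> u v; have := vconj_linear 1 u v; rewrite scale1r conjc1 scale1r.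
have vconj0 : vconj 0 = 0 :> VC by rewrite /vconj /= oppr0.
exists (\sum_(i < n) (c i)^*%C *: vconj (z i)).
  exists n, (fun i => (c i)^*%C), (fun i => vconj (z i)); split => // i.
  by exists (z i).
have -> : \sum_(i < n) (c i)^*%C *: vconj (z i) = vconj (\sum_(i < n) c i *: z i).
  rewrite (big_morph _ vconjD vconj0); apply: eq_bigr => i _.
  by rewrite -[c i *: _]addr0 vconj_linear vconj0 addr0.
move: yx; set y := \sum_(i < n) _ => yx.
have e : x - vconj y = vconj (vconj x - y).
  have := vconj_linear (-1) y (vconj x); rewrite scaleN1r addrC => ->.
  by rewrite vconjK rmorphN rmorph1 scaleN1r addrC.
rewrite e; change (cdot dV (vconj (vconj x - y)) (vconj (vconj x - y)) < eps).
rewrite cdot_vconj; move: yx; have := dot_ge0 (cdot dV) (vconj x - y).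
change (0 <= cdot dV (vconj x - y) (vconj x - y) ->
  cdot dV (vconj x - y) (vconj x - y) < eps ->
  (cdot dV (vconj x - y) (vconj x - y))^*%C < eps).
case: (cdot _ _ _) => r s; rewrite lecE/= => /andP[/eqP s0 _].
by rewrite s0 /= oppr0.
Qed.

End Conjugation.

Section IsometricEmbedding.
Context {R : realType} {V : lmodType R} (dV : {dot V for @idfun R}).
Local Notation VC := (complexification V).
Local Notation GC := (complexification (V * V)%type).
Local Notation dG := (sum_dot dV dV).

(* The embedding of VC into the complexification of V + V under which the
   sample of W is Z. *)
Definition iso_letter (h : VC) : GC :=
  ((Num.sqrt 2)^-1 *: (h.1, - h.2), (Num.sqrt 2)^-1 *: (h.2, h.1)).

(** Conjugating twice restores complex linearity, as the slots of a complex tensor demand. At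
    [vconj h] the result is the conjugate of [iso_letter h], whose sample is the conjugate of
    Z(h). *)
Definition conj_letter (h : VC) : GC := vconj (iso_letter (vconj h)).

Lemma invsqrt2_sqr : (Num.sqrt 2)^-1 ^+ 2 = 2^-1 :> R.
Proof. by rewrite exprVn sqr_sqrtr. Qed.

Lemma iso_letter_linear (a : R[i]) (x y : VC) :
  iso_letter (a *: x + y) = a *: iso_letter x + iso_letter y.
Proof.
have ext (u v : GC) : u.1.1 = v.1.1 -> u.1.2 = v.1.2 -> u.2.1 = v.2.1 ->
    u.2.2 = v.2.2 -> u = v.
  by case: u v => [[? ?] [? ?]] [[? ?] [? ?]] /= -> -> -> ->.
case: a x y => [a a'] [x1 x2] [y1 y2].
apply: ext; rewrite /= !(scalerDr, scalerN, scalerA, opprD, opprK) ?(mulrC _ (Num.sqrt 2)^-1) //.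
Qed.

Lemma conj_letter_linear (a : R[i]) (x y : VC) :
  conj_letter (a *: x + y) = a *: conj_letter x + conj_letter y.
Proof. by rewrite /conj_letter vconj_linear iso_letter_linear vconj_linear conjcK. Qed.

Lemma real_sqnorm_iso_letter h : real_sqnorm dG (iso_letter h) = complex.Re (cdot dV h h).
Proof.
rewrite /real_sqnorm /iso_letter !linearZl_LR !linearZr_LR /= /sum_dot /= !linearNl !linearNr /= opprK.
rewrite /GRing.scale /= !mulrA -expr2 invsqrt2_sqr.
by set a := dV _ _; set b := dV _ _; field.
Qed.

Lemma real_sqnorm_vconj (x : GC) : real_sqnorm dG (vconj x) = real_sqnorm dG x.
Proof. by rewrite /real_sqnorm dotN. Qed.

Lemma real_sqnorm_conj_letter h :
  real_sqnorm dG (conj_letter h) = complex.Re (cdot dV h h).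
Proof.
by rewrite real_sqnorm_vconj real_sqnorm_iso_letter cdot_vconj; case: (cdot _ _ _).
Qed.

(** Circularity of Z: the contributions of X and Y cancel. Hence a letter is contracted with
    conjugate letters only. *)
Lemma covariance_iso_iso x y : covariance_form dG (iso_letter x) (iso_letter y) = 0.
Proof.
rewrite /covariance_form /cdot /iso_letter !linearZl_LR /= !linearNr !linearZr_LR /=.
rewrite /sum_dot /= !linearNl !linearNr /= /GRing.scale/=.
by apply/eqP; rewrite eq_complex/=; apply/andP; split; apply/eqP; ring.
Qed.

Lemma covariance_iso_conj x y :
  covariance_form dG (iso_letter x) (vconj (iso_letter y)) = cdot dV x y.
Proof.
rewrite /covariance_form vconjK /cdot /iso_letter !linearZl_LR /= !linearZr_LR /=.
rewrite /sum_dot /= !linearNl !linearNr /= /GRing.scale/= !mulrA -expr2 invsqrt2_sqr.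
by congr (_ +i* _); field.
Qed.

Lemma covariance_conj_conj x y :
  covariance_form dG (vconj (iso_letter x)) (vconj (iso_letter y)) = 0.
Proof.
have := covariance_iso_iso x y; rewrite /covariance_form cdot_vconj => ->.
by rewrite conjc0.
Qed.

Context {disp : measure_display} {Om : measurableType disp}.
Variables (P : probability Om R) (X Y : V -> {RV P >-> R}).
Hypotheses (isoX : isonormal dV X) (isoY : isonormal dV Y).

Lemma sample_iso_letter h :
  {ae P, forall w, sample X Y (iso_letter h) w = Z_process X Y h w}.
Proof.
have Z0 (Z : V -> {RV P >-> R}) : isonormal dV Z -> forall a h,
    {ae P, forall w, Z (a *: h) w = a * Z h w}.
  move=> isoZ a k; have h1 := isonormal_ae_linear isoZ a k 0.
  (* Linearity at zero vectors reads Z 0 = Z 0 + Z 0, which gives Z 0 = 0 almost everywhere. *)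
  have h2 := isonormal_ae_linear isoZ 1 0 0.
  apply: filterS2 h1 h2 => w; rewrite addr0 scaler0 addr0 => -> h0.
  suff -> : Z 0 w = 0 by rewrite addr0.
  by lra.
set s := (Num.sqrt 2)^-1 : R.
have h1 := Z0 _ isoX s h.1; have h2 := Z0 _ isoY (- s) h.2.
have h3 := Z0 _ isoX s h.2; have h4 := Z0 _ isoY s h.1.
apply: filterS4 h1 h2 h3 h4 => w h1 h2 h3 h4.
rewrite /sample /W_process /iso_letter /= -/s scalerN -scaleNr h1 h2 h3 h4.
rewrite /Z_process /complex_process /=.
have -> : ((Num.sqrt 2)%:C)^-1 = s%:C by rewrite -fmorphV.
by simpc; congr (_ +i* _); ring.
Qed.

Lemma sample_vconj x : {ae P, forall w, sample X Y (vconj x) w = (sample X Y x w)^*%C}.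
Proof.
have h1 := W_process_ae_linear isoX isoY (-1) x.2 0.
have h2 := W_process_ae_linear isoX isoY 1 0 0.
apply: filterS2 h1 h2 => w; rewrite addr0 scaler0 addr0 scaleN1r => h1 h0.
rewrite /sample /= h1.
suff -> : W_process X Y 0 w = 0 by congr (_ +i* _); ring.
by lra.
Qed.

End IsometricEmbedding.

(** * The real and the complex integrals as Wick variables *)

Section Multiplicities.

Definition multiset_seq (N : nat) (m : nat -> nat) : seq nat :=
  flatten [seq nseq (m k) k | k <- iota 0 N].

Lemma count_multiset_seq N m k : count_mem k (multiset_seq N m) = if (k < N)%N then m k else 0%N.
Proof.
rewrite /multiset_seq count_flatten -map_comp sumnE big_map.
have -> : iota 0 N = index_iota 0 N by rewrite /index_iota subn0.
rewrite big_mkord; under eq_bigr do rewrite /= count_nseq/=.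
case: ifPn => kN.
  rewrite (bigD1 (Ordinal kN))//= eqxx mul1n big1 ?addn0// => i.
  by rewrite -val_eqE/= => /negbTE ->; rewrite mul0n.
rewrite big1// => i _; rewrite (_ : (_ == _) = false) ?mul0n//.
by apply/eqP => ik; move: kN; rewrite -ik ltn_ord.
Qed.

Lemma perm_multiset_seq N (s : seq nat) : all (fun i => i < N)%N s ->
  perm_eq s (multiset_seq N (fun k => count_mem k s)).
Proof.
move=> sN; apply/allP => k _ /=; rewrite count_multiset_seq.
case: ifPn => // kN; rewrite (count_memPn _)//.
by apply: contra kN => /(allP sN).
Qed.

Lemma multi_index_count N (s : seq nat) n : size s = n -> all (fun i => i < N)%N s ->
  multi_index N n (fun k => count_mem k s).
Proof.
move=> sn sN; split=> [k Nk|].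
  by apply/count_memPn; apply/negP => /(allP sN)/=; rewrite ltnNge Nk.
rewrite -sn (perm_size (perm_multiset_seq sN)) /multiset_seq size_flatten.
rewrite /shape -map_comp sumnE big_map.
have -> : iota 0 N = index_iota 0 N by rewrite /index_iota subn0.
by rewrite big_mkord; apply: eq_bigr => i _; rewrite /= size_nseq.
Qed.

Context {K : numFieldType} {theta : K -> K} {V : lmodType K} {dV : {dot V for theta}}
  (TP : tensor_powers dV).

(** Symmetrization forgets the order of the factors, so any word of basis vectors can be sorted into
    the monomial form on which the integrals are prescribed. *)
Lemma symm_pure_powers n N (f : nat -> V) (s : seq nat) :
  size s = n -> all (fun i => i < N)%N s ->
  symm TP n (pure TP (fun i : 'I_n => f (nth 0%N s i))) =
  symm TP n (pure_powers TP n N (fun k => count_mem k s) f).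
Proof.
move=> sn sN; rewrite (symm_pure_perm_eq TP f sn (perm_multiset_seq sN)).
congr (symm _ _ _); rewrite /pure_powers.
have -> : flatten [seq nseq (count_mem k s) (f k) | k <- iota 0 N] =
    map f (multiset_seq N (fun k => count_mem k s)).
  rewrite /multiset_seq map_flatten -map_comp; congr flatten.
  by apply: eq_map => k /=; rewrite map_nseq.
congr pure; apply/funext => i; rewrite (nth_map 0%N)//.
by rewrite -(perm_size (perm_multiset_seq sN)) sn.
Qed.

End Multiplicities.

Section RealIntegral.
Context {disp : measure_display} {Om : measurableType disp} {R : realType}.
Variable P : probability Om R.
Context {V : lmodType R} (dV : {dot V for @idfun R}) (X Y : V -> {RV P >-> R}).
Hypotheses (isoX : isonormal dV X) (isoY : isonormal dV Y).
Variables (He : nat -> R -> R) (HeP : hermite_polynomials He).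
Variable TR : tensor_powers (sum_dot dV dV).
Variables (eta : nat -> (V * V)%type)
  (etaP : complete_orthonormal_system (sum_dot dV dV) eta).
Variables (n : nat) (I : tpow TR n -> Om -> R)
  (IP : wiener_ito_integral P (W_process X Y) He eta I).

Lemma Lfun2_measurable (f : Om -> R) : f \in Lfun P 2%:E -> measurable_fun [set: Om] f.
Proof. by rewrite inE => /andP[mf _]; move: mf; rewrite inE. Qed.

Lemma wi_measurable F : sympow F -> measurable_fun [set: Om] (I F).
Proof. by move=> /(wi_chaos IP)[/Lfun2_measurable]. Qed.

(** [I] is constrained on symmetric tensors only; composing with [symm] gives a functional on all
    tensors, as the slot-by-slot argument requires. *)
Definition real_functional (F : tpow TR n) (w : Om) : R[i] := (I (symm TR n F) w)%:C.

Lemma real_functional_ae_linear : ae_linear P (real_complex R) real_functional.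
Proof.
move=> a F G.
have := wi_linear IP a (sympow_symm F) (sympow_symm G); apply: filterS => w.
by rewrite /real_functional linearP /= => ->; rewrite rmorphD rmorphM.
Qed.

Lemma real_functional_ae_continuous :
  ae_continuous P (hdot (tpow TR n)) real_functional.
Proof.
have [C FC] := symm_bounded TR n; pose M : R := n`!%:R * (`|C| + 1).
have M0 : 0 < M by rewrite mulr_gt0 ?ltr0n ?fact_gt0// ltr_wpDl.
exists (fun=> 1) => // eps e0; exists (eps / M); first by rewrite divr_gt0.
move=> F Fd; exists (fun w => I (symm TR n F) w ^+ 2).
  have sF := sympow_symm F.
  split; [exact/measurable_funX/wi_measurable|by move=> w; exact: sqr_ge0|].
  rewrite (L2norm_sqr_integral (wi_isometry IP sF)) lee_fin exprMn !sqr_sqrtr ?ler0n ?dot_ge0//.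
  move: Fd; rewrite ltr_pdivlMr// => /ltW; apply: le_trans.
  rewrite mulrC /M mulrCA mulrC ler_wpM2l ?ler0n//.
  apply: (le_trans (FC F)); rewrite mulrC ler_wpM2l ?dot_ge0//.
  by rewrite (le_trans (ler_norm _))// lerDl.
by apply/nearW => w; rewrite sqmod_real mul1r lerDl ltW.
Qed.

Lemma W_process0 : {ae P, forall w, W_process X Y 0 w = 0}.
Proof.
apply: filterS (W_process_ae_linear isoX isoY 1 0 0) => w.
by rewrite addr0 scaler0 mul1r => /eqP; rewrite -subr_eq0 opprD addNKr oppr_eq0 => /eqP.
Qed.

Lemma real_integral_pure (x : nat -> (V * V)%type) :
  {ae P, forall w, real_functional (pure TR (fun i : 'I_n => x i)) w =
    wick_variable dV X Y (mkseq (@real_embedding _ _ \o x) n) w}.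
Proof.
pose emb := @real_embedding R (V * V)%type.
have [[eta_ortho _ eta_total] eta_norm] := etaP.
have -> : mkseq (emb \o x) n = [::] ++ map emb (mkseq x n) ++ [::].
  by rewrite cats0 /= -map_comp.
have emb_lin (a : R) y z : emb (a *: y + z) = a%:C *: emb y + emb z.
  rewrite /emb /real_embedding /GRing.scale /= /complexification_scale /=.
  by congr pair; rewrite /= ?scaler0 ?scale0r ?subr0 ?addr0.
apply: (ae_eq_on_pure_tensors eta_total real_functional_ae_linear
  real_functional_ae_continuous (phi := fun s => wick_variable dV X Y ([::] ++ map emb s ++ [::]))).
- exact: (wick_variable_comp_ae_linear isoX isoY (iota := real_complex R)).
- apply: (wick_variable_comp_ae_continuous isoX isoY (E := (V * V)%type)) => eps e0.
  exists eps => // d; rewrite /real_sqnorm /= [X in _ + X](_ : _ = 0) ?addr0//.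
  by rewrite linear0l.
move=> {}x xeta.
have /choice[m mx] : forall i, exists m, (i < n)%N -> x i = eta m.
  move=> i; have [ilt|_] := boolP (i < n)%N; last by exists 0%N.
  by have [m _ <-] := xeta i ilt; exists m.
pose s := mkseq m n; pose N := (\max_(i <- s) i).+1.
have ss : size s = n by rewrite size_mkseq.
have sN : all (fun i => i < N)%N s.
  by apply/allP => i si; rewrite ltnS; exact: (@leq_bigmax_seq _ _ xpredT id).
have E1 : pure TR (fun i : 'I_n => x i) = pure TR (fun i : 'I_n => eta (nth 0%N s i)).
  by congr pure; apply/funext => i; rewrite nth_mkseq// mx.
have E2 : mkseq x n = map eta s.
  by rewrite -map_comp; apply/eq_in_map => i; rewrite mem_iota => /mx.
rewrite E1 E2 /real_functional (symm_pure_powers TR eta ss sN).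
have := wi_hermite IP (multi_index_count ss sN); apply: filterS2 W_process0 => w w0 ->.
rewrite cats0 cat0s -map_comp /wick_variable.
(* The imaginary part of this sample is [W] at 0, which vanishes only almost everywhere; hence
   [w0]. *)
have W0 k : sample X Y (emb (eta k)) w = (W_process X Y (eta k) w)%:C.
  by rewrite /sample w0.
rewrite (@wick_hermite _ _ _ _ N (emb \o eta) (fun k n => (He n (W_process X Y (eta k) w))%:C)).
- by rewrite rmorph_prod.
- move=> i j; rewrite /covariance_form /cdot /emb /real_embedding.
  have d0l g : sum_dot dV dV 0 g = 0 by rewrite /sum_dot /= !linear0l addr0.
  have d0r g : sum_dot dV dV g 0 = 0 by rewrite /sum_dot /= !linear0r addr0.
  rewrite /= ?oppr0 !d0l !d0r subr0 addr0.
  case: (eqVneq j i) => [->|/eqP ji]; first by rewrite eta_norm.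
  by rewrite eta_ortho// => ij; apply: ji.
- by move=> k; have [->] := hermite_rec (W_process X Y (eta k) w) HeP.
- move=> k m'; have [_ ->] := hermite_rec (W_process X Y (eta k) w) HeP.
  by rewrite W0 rmorphB !rmorphM rmorph_nat.
- exact: sN.
Qed.

End RealIntegral.

Lemma conjc_realM {R : rcfType} (r : R) (z : R[i]) : ((r%:C * z)^*)%C = r%:C * (z^*)%C.
Proof.
by case: z => a b; apply/eqP; rewrite eq_complex/=; apply/andP; split; apply/eqP; ring.
Qed.

Section ScaledComplexHermite.
Context {R : realType} (J : nat -> nat -> R[i] -> R[i]).
Hypothesis JP : complex_hermite_polynomials J.

(** The factor prescribed for the complex integral. The scaling changes the contraction coefficient
    2 of [J] into 1, the value of E|Z(xi_k)|^2. *)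
Definition scaled_complex_hermite (z : R[i]) (p q : nat) : R[i] :=
  (2 `^ (- (p + q)%:R / 2))%:C * J p q ((Num.sqrt 2)%:C * z).

Let scaleE n : 2 `^ (- n%:R / 2) = (Num.sqrt 2)^-1 ^+ n :> R.
Proof.
rewrite exprVn -powR_mulrn ?sqrtr_ge0// -powR12_sqrt// -powRrM -powRN.
by congr (_ `^ _); field.
Qed.

Let s2 : (Num.sqrt 2)%:C * ((Num.sqrt 2)^-1)%:C = 1 :> R[i].
Proof. by rewrite -rmorphM divff// gt_eqF// sqrtr_gt0. Qed.

Let s2' : 2 * ((Num.sqrt 2)^-1)%:C * ((Num.sqrt 2)^-1)%:C = 1 :> R[i].
Proof.
rewrite -mulrA -rmorphM -expr2 invsqrt2_sqr -(rmorph_nat (real_complex R)) -rmorphM.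
by rewrite divff.
Qed.

Lemma scaled_complex_hermite00 z : scaled_complex_hermite z 0 0 = 1.
Proof.
by rewrite /scaled_complex_hermite scaleE expr0 complex_hermiteE //= expr0 mulr1.
Qed.

Lemma scaled_complex_hermiteSl z p q : scaled_complex_hermite z p.+1 q =
  z * scaled_complex_hermite z p q - q%:R * scaled_complex_hermite z p q.-1.
Proof.
rewrite /scaled_complex_hermite !scaleE !complex_hermiteE // conjc_realM /=.
set z' := (Num.sqrt 2)%:C * z; set w' := _ * z^*%C.
(* The rest regroups factors around [t * s = 1] for the leading term and [2 * s * s = 1] for the
   contraction. *)
rewrite !rmorphXn; move: s2 s2'; set s := (_^-1)%:C; set t := (Num.sqrt 2)%:C in z' w' *.
move=> ts ss; rewrite addSn exprS.
case: q => [|q] /=.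
  rewrite !mul0r !subr0 addn0 /z'.
  by rewrite -[LHS]mul1r -[X in X * _]mulr1;
    transitivity (t * s * (z * (s ^+ p * complex_hermite (t * z) w' p 0)));
    [ring|rewrite ts mul1r].
rewrite addnS exprS.
transitivity ((t * s) * (z * (s * s ^+ (p + q) * complex_hermite z' w' p q.+1)) -
  (2 * s * s) * (q.+1%:R * (s ^+ (p + q) * complex_hermite z' w' p q))).
  by rewrite /z'; ring.
by rewrite ts ss !mul1r.
Qed.

Lemma scaled_complex_hermiteSr z p q : scaled_complex_hermite z p q.+1 =
  (z^*)%C * scaled_complex_hermite z p q - p%:R * scaled_complex_hermite z p.-1 q.
Proof.
rewrite /scaled_complex_hermite !scaleE !complex_hermiteE // complex_hermiteSr.
rewrite conjc_realM.
set z' := (Num.sqrt 2)%:C * z.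
rewrite !rmorphXn; move: s2 s2'; set s := (_^-1)%:C; set t := (Num.sqrt 2)%:C in z' *.
move=> ts ss; rewrite addnS exprS.
case: p => [|p].
  rewrite /= !mul0r !subr0 add0n.
  by transitivity (t * s * (z^*%C * (s ^+ q * (t * z^*%C) ^+ q))); [ring|rewrite ts mul1r].
rewrite addSn exprS.
set h := complex_hermite _ _; rewrite [p.+1.-1]/=.
transitivity ((t * s) * (z^*%C * (s * s ^+ (p + q) * h p.+1 q)) -
  (2 * s * s) * (p.+1%:R * (s ^+ (p + q) * h p q))).
  by ring.
by rewrite ts ss !mul1r.
Qed.

End ScaledComplexHermite.

(** * The complex integral on pure tensors *)

Section ComplexIntegral.
Context {disp : measure_display} {Om : measurableType disp} {R : realType}.
Variable P : probability Om R.
Context {V : lmodType R} (dV : {dot V for @idfun R}) (X Y : V -> {RV P >-> R}).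
Hypotheses (isoX : isonormal dV X) (isoY : isonormal dV Y).
Variables (J : nat -> nat -> R[i] -> R[i]) (JP : complex_hermite_polynomials J).
Variable TC : tensor_powers (cdot dV).
Variables (xi : nat -> complexification V)
  (xiP : complete_orthonormal_system (cdot dV) xi).
Variables (p q : nat) (S : hilbert (@Num.conj R[i]))
  (ten : {bilinear tpow TC p -> tpow TC q -> S})
  (tenP : hilbert_tensor (hdot (tpow TC p)) (hdot (tpow TC q)) ten)
  (CI : S -> Om -> R[i])
  (CIP : complex_wiener_ito_integral P (Z_process X Y) J xi ten CI).

Lemma sympow_tensor_ten F G : sympow F -> sympow G -> sympow_tensor ten (ten F G).
Proof. by move=> sF sG; apply: sub_closed_span; exists (F, G). Qed.

Lemma cwi_square f : sympow_tensor ten f ->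
  [/\ measurable_fun [set: Om] (fun w => sqmod (CI f w)) &
   (\int[P]_w (sqmod (CI f w))%:E = ((p`! * q`!)%:R * complex.Re (hdot S f f))%:E)%E].
Proof.
move=> sf; have [/Lfun2_measurable mRe /Lfun2_measurable mIm] := cwi_L2 CIP sf.
split; first by apply: measurable_funD; exact: measurable_funX.
under eq_integral do rewrite -normc_sqr.
rewrite (L2norm_sqr_integral (cwi_isometry CIP sf)) exprMn !sqr_sqrtr ?ler0n//.
by have := dot_ge0 (hdot S) f; rewrite lecE/= => /andP[].
Qed.

Lemma dot_ten F G : hdot S (ten F G) (ten F G) = hdot (tpow TC p) F F * hdot (tpow TC q) G G.
Proof. by have [-> _] := tenP. Qed.

Let CI_continuous (E : lmodType R[i]) (dE : {dot E for @Num.conj R[i]}) (l : E -> S) (c : R[i]) :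
  (forall x, sympow_tensor ten (l x)) -> 0 <= c ->
  (forall x, hdot S (l x) (l x) <= c * dE x x) ->
  ae_continuous P dE (fun x => CI (l x)).
Proof.
move=> ls c0 lc; pose M : R := (p`! * q`!)%:R.
have M0 : 0 < M by rewrite ltr0n muln_gt0 !fact_gt0.
have M0' : 0 < M%:C by rewrite ltcR.
exists (fun=> 1) => // eps e0; exists (eps%:C / (M%:C * (c + 1))).
  by rewrite divr_gt0 ?ltcR// mulr_gt0// ltr_wpDl.
move=> x; rewrite ltr_pdivlMr; last by rewrite mulr_gt0// ltr_wpDl.
move=> xe; exists (fun w => sqmod (CI (l x) w)).
  have [ms Is] := cwi_square (ls x).
  split=> // [w|]; first exact: sqmod_ge0.
  rewrite Is lee_fin -/M.
  have : M%:C * hdot S (l x) (l x) <= eps%:C.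
    apply: le_trans (ltW xe); rewrite mulrCA ler_pM2l// (le_trans (lc x))// mulrC.
    by rewrite ler_wpM2l ?dot_ge0// lerDl.
  by rewrite lecE Re_realM => /andP[].
by apply/nearW => w; rewrite mul1r lerDl ltW.
Qed.

Let l_continuous (l : complexification V -> complexification (V * V)%type) :
  (forall h, real_sqnorm (sum_dot dV dV) (l h) = complex.Re (cdot dV h h)) ->
  forall eps : R, 0 < eps -> exists2 delta : R[i], 0 < delta &
    forall d, cdot dV d d < delta -> real_sqnorm (sum_dot dV dV) (l d) < eps.
Proof.
move=> lE eps e0; exists eps%:C; first by rewrite ltcR.
by move=> d; rewrite lE ltcE/= => /andP[].
Qed.

(** The slots of the two tensor powers are freed in turn: all vectors in the basis ([basis]), then
    [h] arbitrary ([first_slots]), then [g] arbitrary, starting from conjugated basis vectors.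
    Conjugate letters come first in the word, to match [kernel_letter]. *)
Lemma complex_integral_pure (h g : nat -> complexification V) :
  {ae P, forall w,
    CI (ten (symm TC p (pure TC (fun i : 'I_p => h i)))
            (symm TC q (pure TC (fun i : 'I_q => g i)))) w =
    wick_variable dV X Y
      (map (@conj_letter R V) (mkseq g q) ++ map (@iso_letter R V) (mkseq h p)) w}.
Proof.
have [[xi_ortho _ xi_total] xi_norm] := xiP.
have linearS n (a : R[i]) (F G : tpow TC n) : symm TC n (a *: F + G) = a *: symm TC n F + symm TC n G.
  by rewrite linearP.
have symm_bound n : exists2 C : R[i], 0 <= C & forall F : tpow TC n,
    hdot (tpow TC n) (symm TC n F) (symm TC n F) <= C * hdot (tpow TC n) F F.
  have [C FC] := symm_bounded TC n; exists `|C| => // F.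
  have [->|F0] := eqVneq F 0; first by rewrite !linear0 ?linear0l ?mulr0.
  have F1 := @neq0_dnorm_gt0 _ _ _ (hdot (tpow TC n)) _ F0.
  rewrite ger0_norm// -(pmulr_lge0 _ F1); apply: le_trans (FC F); exact: dot_ge0.
have basis (x : nat -> complexification V) (y : nat -> complexification V) :
   (forall i, (i < p)%N -> range xi (x i)) ->
   (forall i, (i < q)%N -> (@vconj R V @` range xi) (y i)) ->
   {ae P, forall w, CI (ten (symm TC p (pure TC (fun i : 'I_p => x i)))
            (symm TC q (pure TC (fun i : 'I_q => y i)))) w =
    wick_variable dV X Y
      (map (@conj_letter R V) (mkseq y q) ++ map (@iso_letter R V) (mkseq x p)) w}.
  move=> xA yA.
  have /choice[m mx] : forall i, exists m, (i < p)%N -> x i = xi m.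
    move=> i; have [ilt|_] := boolP (i < p)%N; last by exists 0%N.
    by have [k _ <-] := xA i ilt; exists k.
  have /choice[m' my] : forall i, exists m, (i < q)%N -> y i = vconj (xi m).
    move=> i; have [ilt|_] := boolP (i < q)%N; last by exists 0%N.
    by have [_ [k _ <-] <-] := yA i ilt; exists k.
  pose s := mkseq m p; pose t := mkseq m' q; pose N := (\max_(i <- s ++ t) i).+1.
  have ss : size s = p by rewrite size_mkseq.
  have st : size t = q by rewrite size_mkseq.
  have stN : all (fun i => i < N)%N (s ++ t).
    by apply/allP => i si; rewrite ltnS; exact: (@leq_bigmax_seq _ _ xpredT id).
  have := stN; rewrite all_cat => /andP[sN tN].
  have -> : pure TC (fun i : 'I_p => x i) = pure TC (fun i : 'I_p => xi (nth 0%N s i)).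
    by congr pure; apply/funext => i; rewrite nth_mkseq// mx.
  have -> : pure TC (fun i : 'I_q => y i) = pure TC (fun i : 'I_q => vconj (xi (nth 0%N t i))).
    by congr pure; apply/funext => i; rewrite nth_mkseq// my.
  have -> : mkseq x p = map xi s.
    by rewrite -map_comp; apply/eq_in_map => i; rewrite mem_iota => /mx.
  have -> : mkseq y q = map (fun k => vconj (xi k)) t.
    by rewrite -map_comp; apply/eq_in_map => i; rewrite mem_iota => /my ->.
  rewrite (symm_pure_powers TC xi ss sN) (symm_pure_powers TC (fun k => vconj (xi k)) st tN).
  have H1 := cwi_hermite CIP (multi_index_count ss sN) (multi_index_count st tN).
  have H2 : {ae P, forall w, forall k, sample X Y (iso_letter (xi k)) w = Z_process X Y (xi k) w}.
    by apply: ae_foralln => k; exact: (sample_iso_letter isoX isoY).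
  have H3 : {ae P, forall w, forall k, sample X Y (vconj (iso_letter (xi k))) w =
      (sample X Y (iso_letter (xi k)) w)^*%C}.
    by apply: ae_foralln => k; exact: (sample_vconj isoX isoY).
  apply: filterS3 H1 H2 H3 => w -> H2 H3.
  pose f (kb : nat * bool) := if kb.2 then vconj (iso_letter (xi kb.1)) else iso_letter (xi kb.1).
  have -> : map (@conj_letter R V) [seq vconj (xi k) | k <- t] ++
      map (@iso_letter R V) (map xi s) =
      map f ([seq (k, true) | k <- t] ++ [seq (k, false) | k <- s]).
    rewrite map_cat -!map_comp; congr (_ ++ _); apply: eq_map => k //=.
    by rewrite /conj_letter vconjK.
  rewrite /wick_variable.
  rewrite (@wick_complex_hermite _ _ _ _ N f
    (fun k => scaled_complex_hermite J (Z_process X Y (xi k) w))).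
  - apply: eq_bigr => k _; rewrite /scaled_complex_hermite !count_cat.
    have ct b b' (u : seq nat) : count_mem (k : nat, b') [seq (l, b) | l <- u] =
        if b == b' then count_mem (k : nat) u else 0%N.
      rewrite count_map; case: ifPn => bb'; last rewrite -(count_pred0 u);
        apply: eq_count => l /=; rewrite xpair_eqE.
        by rewrite bb' andbT.
      by rewrite (negbTE bb') andbF.
    by rewrite !ct /= addn0 add0n.
  - move=> [i b] [j b'] /=; rewrite /f /=.
    have C i' j' : cdot dV (xi i') (xi j') = (j' == i')%:R.
      case: (eqVneq j' i') => [->|/eqP ji]; first by rewrite xi_norm.
      by rewrite xi_ortho// => ij; apply: ji.
    rewrite xpair_eqE; case: b b' => [] [] /=; rewrite ?andbT ?andbF.
    + by rewrite covariance_conj_conj.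
    + by rewrite covariance_form_sym covariance_iso_conj C eq_sym.
    + by rewrite covariance_iso_conj C.
    + by rewrite covariance_iso_iso.
  - by move=> k; exact: scaled_complex_hermite00.
  - by move=> k a c; rewrite /f /= H2; exact: scaled_complex_hermiteSl.
  - by move=> k a c; rewrite /f /= H3 H2; exact: scaled_complex_hermiteSr.
  - rewrite all_cat; apply/andP; split; apply/allP => _ /mapP[l lt ->];
      [exact: (allP tN _ lt)|exact: (allP sN _ lt)].
have first_slots (y : nat -> complexification V) :
   (forall i, (i < q)%N -> (@vconj R V @` range xi) (y i)) ->
   forall x : nat -> complexification V,
   {ae P, forall w, CI (ten (symm TC p (pure TC (fun i : 'I_p => x i)))
            (symm TC q (pure TC (fun i : 'I_q => y i)))) w =
    wick_variable dV X Y
      (map (@conj_letter R V) (mkseq y q) ++ map (@iso_letter R V) (mkseq x p)) w}.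
  move=> yA; set G := symm TC q _.
  (* The empty tail brings the word to the prefix, variable part, suffix shape of the Wick
     lemmas. *)
  have e s : map (@conj_letter R V) (mkseq y q) ++ map (@iso_letter R V) s =
      map (@conj_letter R V) (mkseq y q) ++ map (@iso_letter R V) s ++ [::].
    by rewrite cats0.
  have [C C0 HC] := symm_bound p.
  apply: (ae_eq_on_pure_tensors (iota := idfun) xi_total (L := fun F => CI (ten (symm TC p F) G))
    (phi := fun s => wick_variable dV X Y
      (map (@conj_letter R V) (mkseq y q) ++ map (@iso_letter R V) s))).
  - move=> a F1 F2; rewrite linearS linearPl; apply: (cwi_linear CIP);
      exact/sympow_tensor_ten/sympow_symm/sympow_symm.
  - apply: (CI_continuous (c := C * hdot (tpow TC q) G G)).
    + by move=> F; exact/sympow_tensor_ten/sympow_symm/sympow_symm.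
    + by rewrite mulr_ge0// dot_ge0.
    + by move=> F; rewrite dot_ten mulrAC ler_wpM2r ?dot_ge0.
  - under eq_fun do rewrite e.
    apply: (wick_variable_comp_ae_linear isoX isoY (iota := idfun)).
    exact: iso_letter_linear.
  - under eq_fun do rewrite e.
    by apply: (wick_variable_comp_ae_continuous isoX isoY);
      apply: l_continuous; exact: real_sqnorm_iso_letter.
  - by move=> x xA; exact: basis.
move: g; set F := symm TC p _.
have [C C0 HC] := symm_bound q.
apply: (ae_eq_on_pure_tensors (iota := idfun) (vconj_total xi_total) (L := fun G => CI (ten F (symm TC q G)))
    (phi := fun s => wick_variable dV X Y
      ([::] ++ map (@conj_letter R V) s ++ map (@iso_letter R V) (mkseq h p)))).
- move=> a F1 F2; rewrite linearS linearPr; apply: (cwi_linear CIP);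
    exact/sympow_tensor_ten/sympow_symm/sympow_symm.
- apply: (CI_continuous (c := C * hdot (tpow TC p) F F)).
  + by move=> G; exact/sympow_tensor_ten/sympow_symm/sympow_symm.
  + by rewrite mulr_ge0// dot_ge0.
  + by move=> G; rewrite dot_ten mulrC mulrAC ler_wpM2r ?dot_ge0.
- apply: (wick_variable_comp_ae_linear isoX isoY (iota := idfun)).
  exact: conj_letter_linear.
- by apply: (wick_variable_comp_ae_continuous isoX isoY);
      apply: l_continuous; exact: real_sqnorm_conj_letter.
- by move=> y yA; exact: first_slots.
Qed.

End ComplexIntegral.

(** * The representation *)

Section ClosedSpanComplex.
Context {R : realType} {V : lmodType R[i]} (dot : {dot V for @Num.conj R[i]}).

Lemma span_linear (A : set V) a x y : Defs.span A x -> Defs.span A y -> Defs.span A (a *: x + y).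
Proof.
move=> [n [c [u [uA ->]]]] [m [d [v [vA ->]]]].
exists (n + m)%N, (fun i => match fintype.split i with inl j => a * c j | inr j => d j end),
  (fun i => match fintype.split i with inl j => u j | inr j => v j end); split.
  by move=> i; case: (fintype.split i).
rewrite big_split_ord/= scaler_sumr; congr (_ + _); apply: eq_bigr => i _.
  by have := unsplitK (inl i : 'I_n + 'I_m) => /= ->; rewrite scalerA.
by have := unsplitK (inr i : 'I_n + 'I_m) => /= ->.
Qed.

Lemma closed_span_linear (A : set V) a x y :
  closed_span dot A x -> closed_span dot A y -> closed_span dot A (a *: x + y).
Proof.
(* [dotD_le] costs a factor 2 and scaling by [a] a factor |a|^2, so approximations within [eps / M]
   add up to [eps / 2]. *)
move=> Ax Ay eps e0; pose M := 4 * (a * a^*%C + 1).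
have aa : 0 <= a * a^*%C := mulcJ_ge0 a.
have M0 : 0 < M by rewrite mulr_gt0// ltr_wpDl.
have [|x' Ax' xx'] := Ax (eps / M); first by rewrite divr_gt0.
have [|y' Ay' yy'] := Ay (eps / M); first by rewrite divr_gt0.
exists (a *: x' + y'); first exact: span_linear.
have -> : a *: x + y - (a *: x' + y') = a *: (x - x') + (y - y').
  by rewrite scalerBr opprD addrACA.
apply: (le_lt_trans (dotD_le _ _ _)).
have -> : dot (a *: (x - x')) (a *: (x - x')) = a * a^*%C * dot (x - x') (x - x').
  by rewrite linearZl_LR linearZr_LR /= mulrA.
have h1 : a * a^*%C * dot (x - x') (x - x') <= a * a^*%C * (eps / M).
  by rewrite ler_wpM2l// ltW.
have h2 : 2 * (a * a^*%C * dot (x - x') (x - x') + dot (y - y') (y - y')) <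
   2 * (a * a^*%C * (eps / M) + eps / M).
  by rewrite ltr_pM2l// ler_ltD.
apply: (lt_le_trans h2).
have -> : 2 * (a * a^*%C * (eps / M) + eps / M) = eps / 2.
  by rewrite /M; field; rewrite gt_eqF// ltr_wpDl.
by rewrite ler_pdivrMr// mulr_natr mulr2n lerDl ltW.
Qed.

End ClosedSpanComplex.

Lemma modulus_ge0 {R : rcfType} (z : R[i]) : 0 <= Normc.normc z.
Proof. by case: z => a b; exact: sqrtr_ge0. Qed.

(** The induction carries two consecutive indices because the recurrence has order two.
    Measurability serves the triangle inequality in L^2 when the limit is shown to lie in the
    chaos. *)
Lemma measurable_hermite {R : realType} (He : nat -> R -> R) n :
  hermite_polynomials He -> measurable_fun [set: R] (He n).
Proof.
move=> HeP; suff [] : measurable_fun [set: R] (He n) /\ measurable_fun [set: R] (He n.+1) by [].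
elim: n => [|n [ih1 ih2]]; split => //.
- rewrite (_ : He 0%N = cst 1)//; apply/funext => x.
  by have [] := hermite_rec x HeP.
- rewrite (_ : He 1%N = id)//; apply/funext => x.
  by have [h0 ->] := hermite_rec x HeP; rewrite h0 mul0r subr0 mulr1.
- rewrite (_ : He n.+2 = (fun x => x * He n.+1 x - n.+1%:R * He n x)).
    apply: measurable_funB; apply: measurable_funM => //.
  by apply/funext => x; have [_ ->] := hermite_rec x HeP.
Qed.

Section Representation.
Context {disp : measure_display} {Om : measurableType disp} {R : realType}.
Variable P : probability Om R.
Variables (H : hilbert (@idfun R)) (X Y : H -> {RV P >-> R}).
Hypotheses (isoX : isonormal (hdot H) X) (isoY : isonormal (hdot H) Y).
Variables (He : nat -> R -> R) (HeP : hermite_polynomials He).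
Variables (J : nat -> nat -> R[i] -> R[i]) (JP : complex_hermite_polynomials J).
Variables (p q : nat) (pq_gt0 : (0 < p + q)%N).
Variables (TR : tensor_powers (sum_dot (hdot H) (hdot H)))
  (eta : nat -> (H * H)%type)
  (etaP : complete_orthonormal_system (sum_dot (hdot H) (hdot H)) eta)
  (I : tpow TR (p + q) -> Om -> R)
  (IP : wiener_ito_integral P (W_process X Y) He eta I)
  (TC : tensor_powers (cdot (hdot H)))
  (Tpq : hilbert (@Num.conj R[i]))
  (ten : {bilinear tpow TC p -> tpow TC q -> Tpq})
  (tenP : hilbert_tensor (hdot (tpow TC p)) (hdot (tpow TC q)) ten)
  (xi : nat -> complexification H)
  (xiP : complete_orthonormal_system (cdot (hdot H)) xi)
  (CI : Tpq -> Om -> R[i])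
  (CIP : complex_wiener_ito_integral P (Z_process X Y) J xi ten CI)
  (e : nat -> complexification H).
Local Notation index := (p.-tuple nat * q.-tuple nat)%type.
Variable b : index -> R[i].

Let elt (kj : index) : Tpq :=
  ten (symm TC p (pure TC (fun i : 'I_p => e (tnth kj.1 i))))
      (symm TC q (pure TC (fun i : 'I_q => vconj (e (tnth kj.2 i))))).

Let kernelE (kj : index) :
  (u_kernel TR e kj, v_kernel TR e kj) =
  (symm TR (p + q) (complex_pure TR (p + q) (kernel_letter e q (nth 0%N kj.2) (nth 0%N kj.1))).1,
   symm TR (p + q) (complex_pure TR (p + q) (kernel_letter e q (nth 0%N kj.2) (nth 0%N kj.1))).2).
Proof.
rewrite /u_kernel /v_kernel -surjective_pairing -uvE//; congr uv.
  by apply/funext => i; rewrite (tnth_nth 0%N).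
by apply/funext => i; rewrite (tnth_nth 0%N).
Qed.

Lemma sympow_u_kernel (kj : index) : @sympow _ _ _ _ TR (p + q) (u_kernel TR e kj).
Proof. by have [-> _] := kernelE kj; exact: sympow_symm. Qed.

Lemma sympow_v_kernel (kj : index) : @sympow _ _ _ _ TR (p + q) (v_kernel TR e kj).
Proof. by have [_ ->] := kernelE kj; exact: sympow_symm. Qed.

Lemma complex_integral_elt (kj : index) :
  {ae P, forall w, CI (elt kj) w = I (u_kernel TR e kj) w +i* I (v_kernel TR e kj) w}.
Proof.
pose k := nth 0%N kj.1; pose j := nth 0%N kj.2.
have H1 := complex_integral_pure isoX isoY JP xiP tenP CIP (e \o k) (@vconj R H \o (e \o j)).
have H2 := ae_eq_complex_pure (real_functional_ae_linear IP)
  (wick_variable_multi_ae_linear isoX isoY)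
  (real_integral_pure isoX isoY HeP etaP IP) (kernel_letter e q j k).
have [-> ->] := kernelE kj.
have -> : elt kj = ten (symm TC p (pure TC (fun i : 'I_p => (e \o k) i)))
    (symm TC q (pure TC (fun i : 'I_q => (@vconj R H \o (e \o j)) i))).
  by congr (ten (symm _ _ (pure _ _)) (symm _ _ (pure _ _))); apply/funext => i;
    rewrite (tnth_nth 0%N).
apply: filterS2 H1 H2 => w ->.
(* The two words agree letter by letter: [(u10 e k, v10 e k)] unfolds to [iso_letter (e k)], and
   [(u01 e j, v01 e j)] to its conjugate. *)
have -> : mkseq (kernel_letter e q j k) (p + q) =
    map (@conj_letter R H) (mkseq (@vconj R H \o (e \o j)) q) ++
    map (@iso_letter R H) (mkseq (e \o k) p).
  rewrite addnC /mkseq iotaD map_cat -!map_comp; congr (_ ++ _).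
    apply/eq_in_map => i; rewrite mem_iota /= => iq.
    by rewrite /kernel_letter iq /conj_letter vconjK.
  rewrite add0n -[X in iota X _]addn0 iotaDl -map_comp.
  apply/eq_map => i /=.
  by rewrite /kernel_letter ltnNge leq_addr /= addKn.
move=> <-; rewrite /real_functional; simpc.
by [].
Qed.

Let M : R := (p`! * q`!)%:R.
Let M_gt0 : 0 < M. Proof. by rewrite ltr0n muln_gt0 !fact_gt0. Qed.

Definition re_kernel (kj : index) :=
  complex.Re (b kj) *: u_kernel TR e kj - complex.Im (b kj) *: v_kernel TR e kj.
Definition im_kernel (kj : index) :=
  complex.Im (b kj) *: u_kernel TR e kj + complex.Re (b kj) *: v_kernel TR e kj.

Lemma sympow_linear n (a : R) (F G : tpow TR n) : sympow F -> sympow G -> sympow (a *: F + G).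
Proof. by rewrite /sympow /= => sF sG; rewrite linearP sF sG. Qed.

Lemma sympow0 n : sympow (0 : tpow TR n).
Proof. by rewrite /sympow /= linear0. Qed.

Lemma sympow_re_kernel (kj : index) : sympow (re_kernel kj).
Proof.
rewrite /re_kernel addrC -scaleNr -[_ *: v_kernel _ _ _]addr0 -addrA add0r.
apply: sympow_linear; first exact: sympow_v_kernel.
rewrite -[_ *: _]addr0; apply: sympow_linear; [exact: sympow_u_kernel|exact: sympow0].
Qed.

Lemma sympow_im_kernel (kj : index) : sympow (im_kernel kj).
Proof.
apply: sympow_linear; first exact: sympow_u_kernel.
rewrite -[_ *: _]addr0; apply: sympow_linear; [exact: sympow_v_kernel|exact: sympow0].
Qed.

Lemma sympow_tensor_elt (kj : index) : sympow_tensor ten (elt kj).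
Proof. by apply: sympow_tensor_ten; exact: sympow_symm. Qed.

Lemma sympow_tensor0 : sympow_tensor ten 0.
Proof.
move=> eps e0; exists 0; last by rewrite subrr linear0l.
exists 0%N, (fun=> 0), (fun=> 0); split; first by case.
by rewrite big_ord0.
Qed.

Lemma wi_linear_pair (a c : R) F G : sympow F -> sympow G ->
  {ae P, forall w, I (a *: F + c *: G) w = a * I F w + c * I G w}.
Proof.
move=> sF sG; have s0 := sympow0 (p + q).
have scG : sympow (c *: G) by rewrite -[_ *: _]addr0; exact: sympow_linear.
have h1 := wi_linear IP a sF scG; have h2 := wi_linear IP c sG s0.
have h3 := wi_linear IP 1 s0 s0.
apply: filterS3 h1 h2 h3 => w -> ; rewrite !addr0 => ->.
by rewrite scaler0 mul1r => h0; congr (_ + _); lra.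
Qed.

(** Multiplying I(u) + i I(v) by the coefficient and separating the parts produces exactly the two
    kernels. *)
Lemma wi_kernels (kj : index) : {ae P, forall w, CI (b kj *: elt kj) w =
  I (re_kernel kj) w +i* I (im_kernel kj) w}.
Proof.
have su := sympow_u_kernel kj; have sv := sympow_v_kernel kj.
have h1 := complex_integral_elt kj.
have h2 := wi_linear_pair (complex.Re (b kj)) (- complex.Im (b kj)) su sv.
have h3 := wi_linear_pair (complex.Im (b kj)) (complex.Re (b kj)) su sv.
have h4 := cwi_linear CIP (b kj) (sympow_tensor_elt kj) sympow_tensor0.
have h5 := cwi_linear CIP 1 sympow_tensor0 sympow_tensor0.
apply: filterS4 (filterI h4 h5) h1 h2 h3 => w [k4 k5] k1 k2 k3.
rewrite /re_kernel -scaleNr k2 /im_kernel k3.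
move: k5; rewrite scaler0 addr0 mul1r => /eqP; rewrite -subr_eq0 opprD addNKr oppr_eq0 => /eqP k5.
move: k4; rewrite addr0 k5 addr0 => ->; rewrite k1.
by case: (b kj) => r s /=; simpc; congr (_ +i* _); ring.
Qed.

Lemma sympow_tensor_sum (B : seq index) : sympow_tensor ten (\sum_(kj <- B) b kj *: elt kj).
Proof.
elim: B => [|kj B ih]; first by rewrite big_nil; exact: sympow_tensor0.
by rewrite big_cons; apply: closed_span_linear => //; exact: sympow_tensor_elt.
Qed.

Lemma sympow_sum (F : index -> tpow TR (p + q)) (B : seq index) :
  (forall kj, sympow (F kj)) -> sympow (\sum_(kj <- B) F kj).
Proof.
move=> sF; elim: B => [|kj B ih]; first by rewrite big_nil; exact: sympow0.
by rewrite big_cons -[F kj]scale1r; exact: sympow_linear.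
Qed.

Lemma wi_sum (F : index -> tpow TR (p + q)) (B : seq index) : (forall kj, sympow (F kj)) ->
  {ae P, forall w, I (\sum_(kj <- B) F kj) w = \sum_(kj <- B) I (F kj) w}.
Proof.
move=> sF; elim: B => [|kj B ih].
  have h := wi_linear IP 1 (sympow0 _) (sympow0 _).
  by apply: filterS h => w; rewrite !big_nil scaler0 addr0 mul1r => h0; lra.
have h := wi_linear IP 1 (sF kj) (sympow_sum B sF).
by apply: filterS2 ih h => w ih; rewrite !big_cons scale1r mul1r -ih.
Qed.

Lemma cwi_sum (B : seq index) : {ae P, forall w, CI (\sum_(kj <- B) b kj *: elt kj) w =
  (\sum_(kj <- B) I (re_kernel kj) w) +i* (\sum_(kj <- B) I (im_kernel kj) w)}.
Proof.
elim: B => [|kj B ih].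
  have h := cwi_linear CIP 1 sympow_tensor0 sympow_tensor0.
  apply: filterS h => w; rewrite !big_nil scaler0 addr0 mul1r => /eqP.
  by rewrite -subr_eq0 opprD addNKr oppr_eq0 => /eqP ->.
have sb : sympow_tensor ten (b kj *: elt kj).
  have := sympow_tensor_sum [:: kj]; by rewrite big_seq1.
have h := cwi_linear CIP 1 sb (sympow_tensor_sum B).
apply: filterS3 ih h (wi_kernels kj) => w ih; rewrite !big_cons scale1r mul1r ih => -> ->.
by simpc.
Qed.

Variables (f : Tpq) (f_sym : sympow_tensor ten f).
Hypothesis f_sum : has_sum (hdot Tpq) (fun kj => b kj *: elt kj) f.

Let gap (B : seq index) : Tpq := \sum_(kj <- B) b kj *: elt kj - f.

Let gapE (B : seq index) : gap B = (-1) *: f + \sum_(kj <- B) b kj *: elt kj.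
Proof. by rewrite scaleN1r addrC. Qed.

Let sympow_tensor_gap B : sympow_tensor ten (gap B).
Proof. by rewrite gapE; apply: closed_span_linear => //; exact: sympow_tensor_sum. Qed.

Let cwi_gap B : {ae P, forall w, CI (gap B) w =
  (\sum_(kj <- B) I (re_kernel kj) w - complex.Re (CI f w)) +i*
  (\sum_(kj <- B) I (im_kernel kj) w - complex.Im (CI f w))}.
Proof.
have h := cwi_linear CIP (-1) f_sym (sympow_tensor_sum B).
apply: filterS2 (cwi_sum B) h => w hB; rewrite gapE hB => ->.
by rewrite mulN1r; case: (CI f w) => r s; simpc; congr (_ +i* _); rewrite addrC.
Qed.

Let measurable_Re g : sympow_tensor ten g ->
  measurable_fun [set: Om] (fun w => complex.Re (CI g w)).
Proof. by move=> /(cwi_L2 CIP)[/Lfun2_measurable]. Qed.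

Let measurable_Im g : sympow_tensor ten g ->
  measurable_fun [set: Om] (fun w => complex.Im (CI g w)).
Proof. by move=> /(cwi_L2 CIP)[_ /Lfun2_measurable]. Qed.

Let measurable_wi_sum (F : index -> tpow TR (p + q)) (B : seq index) :
  (forall kj, sympow (F kj)) ->
  measurable_fun [set: Om] (fun w => \sum_(kj <- B) I (F kj) w).
Proof. by move=> sF; apply: measurable_sum => kj; exact: (wi_measurable IP (sF kj)). Qed.

Let measurable_normc g : sympow_tensor ten g ->
  measurable_fun [set: Om] (fun w => Normc.normc (CI g w)).
Proof.
move=> sg; rewrite (_ : (fun w => _) = (fun w => Num.sqrt (sqmod (CI g w)))); last first.
  by apply/funext => w; case: (CI g w).
have ms : measurable_fun [set: Om] (sqmod \o CI g) by have [] := cwi_square CIP sg.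
exact: (measurableT_comp (continuous_measurable_fun (@sqrt_continuous R)) ms).
Qed.

Let L2norm_gap_small (eps : R) : 0 < eps -> exists A : {fset index},
  forall B : {fset index}, fsubset A B ->
  (L2norm P (fun w => Normc.normc (CI (gap B) w)) < eps%:E)%E.
Proof.
(* [has_sum] measures squared norms, and the isometry multiplies them by [M], that is p! q!. *)
move=> e0; have [|A AP] := f_sum (eps := (eps ^+ 2 / M)%:C).
  by rewrite ltcR divr_gt0// exprn_gt0.
exists A => B /AP; rewrite -/(gap B) ltcE /= => /andP[_].
rewrite ltr_pdivlMr// mulrC => Me.
rewrite (cwi_isometry CIP (sympow_tensor_gap B)) lte_fin -/M -sqrtrM ?ltW//.
by rewrite -[ltRHS](ger0_norm (ltW e0)) -sqrtr_sqr ltr_sqrt ?exprn_gt0.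
Qed.

Let L2norm_re_le (B : seq index) :
  (L2norm P (fun w => \sum_(kj <- B) I (re_kernel kj) w - complex.Re (CI f w))%R <=
   L2norm P (fun w => Normc.normc (CI (gap B) w)))%E.
Proof.
apply: le_L2norm_ae.
- apply: measurable_funB; [exact: (measurable_wi_sum B sympow_re_kernel)|exact: measurable_Re].
- exact: measurable_normc.
- apply: filterS (cwi_gap B) => w hw.
  rewrite (@ger0_norm _ (Normc.normc _)) ?modulus_ge0//.
  by have := normc_ge_absRe (CI (gap B) w); rewrite {1}hw.
Qed.

Let L2norm_im_le (B : seq index) :
  (L2norm P (fun w => \sum_(kj <- B) I (im_kernel kj) w - complex.Im (CI f w))%R <=
   L2norm P (fun w => Normc.normc (CI (gap B) w)))%E.
Proof.
apply: le_L2norm_ae.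
- apply: measurable_funB; [exact: (measurable_wi_sum B sympow_im_kernel)|exact: measurable_Im].
- exact: measurable_normc.
- apply: filterS (cwi_gap B) => w hw.
  rewrite (@ger0_norm _ (Normc.normc _)) ?modulus_ge0//.
  by have := normc_ge_absIm (CI (gap B) w); rewrite {1}hw.
Qed.

Lemma L2_sum_re : L2_sum P (fun kj => I (re_kernel kj)) (fun w => complex.Re (CI f w)).
Proof.
move=> eps /L2norm_gap_small[A AP]; exists A => B /AP.
exact: le_lt_trans (L2norm_re_le B).
Qed.

Lemma L2_sum_im : L2_sum P (fun kj => I (im_kernel kj)) (fun w => complex.Im (CI f w)).
Proof.
move=> eps /L2norm_gap_small[A AP]; exists A => B /AP.
exact: le_lt_trans (L2norm_im_le B).
Qed.

(* The limit lies in the chaos, hence it is the integral of some kernel, to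
   which the partial sums of the kernels converge by isometry. *)
Lemma wi_has_sum (F : index -> tpow TR (p + q)) (Z : Om -> R) :
  (forall kj, sympow (F kj)) -> Z \in Lfun P 2%:E ->
  L2_sum P (fun kj => I (F kj)) Z ->
  exists phi, [/\ sympow phi, has_sum (hdot (tpow TR (p + q))) F phi &
    {ae P, forall w, I phi w = Z w}].
Proof.
move=> sF LZ FZ; have mZ := Lfun2_measurable LZ.
have mF B := measurable_wi_sum B sF.
have mI B := wi_measurable IP (sympow_sum B sF).
have /(wi_onto IP)[phi sphi phiZ] :
    wiener_chaos P (dV := sum_dot (hdot H) (hdot H)) (W_process X Y) He (p + q) Z.
  (* One half is spent on replacing Z by a finite sum, the other on replacing that sum, which is the
     integral of a kernel, by Hermite polynomials. *)
  split=> // eps e0; have [|A AP] := FZ (eps / 2); first by rewrite divr_gt0.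
  have [_ hc] := wi_chaos IP (sympow_sum A sF).
  have [|m [c [h [h1 hcl]]]] := hc (eps / 2); first by rewrite divr_gt0.
  exists m, c, h; split => //; set G := fun w => \sum_(i < m) c i * He (p + q) (W_process X Y (h i) w).
  have mG : measurable_fun [set: Om] G.
    apply: measurable_sum => i; apply: measurable_funM => //.
    have mW : measurable_fun [set: Om] (W_process X Y (h i)) by exact: measurable_funD.
    exact: (measurableT_comp (measurable_hermite (p + q) HeP) mW).
  have mS := mI A; set S := I (\sum_(kj <- A) F kj) in hcl mS.
  rewrite (_ : (fun w => _) = (fun w => Z w - S w) \+ (fun w => S w - G w)); last first.
    by apply/funext => w /=; rewrite addrA subrK.
  apply: (@le_lt_trans _ _ (L2norm P (fun w => Z w - S w)%R + L2norm P (fun w => S w - G w)%R)%E).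
    by apply: minkowski_EFin; rewrite ?ler1n//; exact: measurable_funB.
  rewrite (splitr eps) EFinD; apply: lteD => //.
  apply: le_lt_trans (AP A _); last exact: fsubset_refl.
  apply: le_L2norm_ae; [exact: measurable_funB|exact: measurable_funB|].
  by apply: filterS (wi_sum A sF) => w; rewrite /S => ->; rewrite distrC.
exists phi; split => // eps e0.
have [|A AP] := FZ (Num.sqrt eps); first by rewrite sqrtr_gt0.
exists A => B /AP LB; set D := \sum_(kj <- B) F kj - phi.
have DE : D = (-1) *: phi + \sum_(kj <- B) F kj by rewrite scaleN1r addrC.
have sS := sympow_sum B sF.
have sD : sympow D by rewrite DE; exact: sympow_linear.
have : (L2norm P (I D) < (Num.sqrt eps)%:E)%E.
  apply: le_lt_trans LB; apply: le_L2norm_ae; [exact: (wi_measurable IP)|exact: measurable_funB|].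
  have h := wi_linear IP (-1) sphi sS; rewrite -DE in h.
  apply: filterS3 h phiZ (wi_sum B sF) => w -> -> ->.
  by rewrite mulN1r addrC.
rewrite (wi_isometry IP sD) lte_fin => DB.
rewrite -(@ltr_sqrt _ _ eps) //; apply: le_lt_trans DB.
rewrite ler_peMl ?sqrtr_ge0// -{1}(sqrtr1 R) ler_sqrt ?ler0n// ler1n.
by rewrite fact_gt0.
Qed.

(** The integral of the difference vanishes almost everywhere, and by the isometry its norm is a
    positive multiple of the norm of the difference of the kernels. *)
Lemma wi_kernel_unique phi phi' : sympow phi -> sympow phi' ->
  {ae P, forall w, I phi w = I phi' w} -> phi = phi'.
Proof.
move=> sphi sphi' phiE.
have s : sympow ((-1) *: phi' + phi) by exact: sympow_linear.
have h := wi_linear IP (-1) sphi' sphi.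
have L0 : L2norm P (I ((-1) *: phi' + phi)) = 0%E.
  transitivity (L2norm P (fun=> 0 : R)).
    apply: eq_L2norm_ae => //; first exact: (wi_measurable IP).
    by apply: filterS2 phiE h => w -> ->; rewrite mulN1r addNr.
  by rewrite L2normE expr0n /=; under eq_integral do []; rewrite integral0 poweR0r// invr_neq0.
have := wi_isometry IP s; rewrite L0 => -[] /esym/eqP.
rewrite mulf_eq0 sqrtr_eq0 lern0 -leqn0 leqNgt fact_gt0 /= sqrtr_eq0 => /dot_le0_eq0.
by rewrite scaleN1r addrC => /eqP; rewrite subr_eq0 => /eqP.
Qed.

End Representation.

Unset Implicit Arguments.

Theorem theorem3p9 (disp : measure_display) (Om : measurableType disp)
  (R : realType) (P : probability Om R)
  (H : hilbert (@idfun R)) (Hsep : separable_space (hdot H))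
  (X Y : H -> {RV P >-> R})
  (isoX : isonormal (hdot H) X) (isoY : isonormal (hdot H) Y)
  (indXY : independent_processes X Y)
  (He : nat -> R -> R) (HeP : hermite_polynomials He)
  (J : nat -> nat -> R[i] -> R[i]) (JP : complex_hermite_polynomials J)
  (p q : nat) (pq_gt0 : (0 < p + q)%N)
  (TR : tensor_powers (sum_dot (hdot H) (hdot H)))
  (eta : nat -> (H * H)%type)
  (etaP : complete_orthonormal_system (sum_dot (hdot H) (hdot H)) eta)
  (I : tpow TR (p + q) -> Om -> R)
  (IP : wiener_ito_integral P (W_process X Y) He eta I)
  (TC : tensor_powers (cdot (hdot H)))
  (Tpq : hilbert (@Num.conj R[i]))
  (ten : {bilinear tpow TC p -> tpow TC q -> Tpq})
  (tenP : hilbert_tensor (hdot (tpow TC p)) (hdot (tpow TC q)) ten)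
  (xi : nat -> complexification H)
  (xiP : complete_orthonormal_system (cdot (hdot H)) xi)
  (CI : Tpq -> Om -> R[i])
  (CIP : complex_wiener_ito_integral P (Z_process X Y) J xi ten CI)
  (e : nat -> complexification H)
  (eP : complete_orthogonal_system (cdot (hdot H)) e)
  (e_norm : forall k, cdot (hdot H) (e k) (e k) = 2)
  (b : p.-tuple nat * q.-tuple nat -> R[i])
  (b_summable :
     (\esum_(kj in [set: p.-tuple nat * q.-tuple nat])
        ((Normc.normc (b kj)) ^+ 2)%:E < +oo)%E)
  (f : Tpq) (f_sym : sympow_tensor ten f)
  (f_sum : has_sum (hdot Tpq)
     (fun kj => b kj *:
        ten (symm TC p (pure TC (fun i : 'I_p => e (tnth kj.1 i))))
            (symm TC q (pure TC (fun i : 'I_q => vconj (e (tnth kj.2 i)))))) f) :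
  let re_kernel kj :=
    complex.Re (b kj) *: u_kernel TR e kj - complex.Im (b kj) *: v_kernel TR e kj in
  let im_kernel kj :=
    complex.Im (b kj) *: u_kernel TR e kj + complex.Re (b kj) *: v_kernel TR e kj in
  [/\ L2_sum P (fun kj => I (re_kernel kj)) (fun w => complex.Re (CI f w)),
      L2_sum P (fun kj => I (im_kernel kj)) (fun w => complex.Im (CI f w)) &
      exists phi psi : tpow TR (p + q),
        [/\ sympow phi /\ sympow psi,
            has_sum (hdot (tpow TR (p + q))) re_kernel phi,
            has_sum (hdot (tpow TR (p + q))) im_kernel psi,
            {ae P, forall w, CI f w = I phi w +i* I psi w} &
            forall phi' psi' : tpow TR (p + q), sympow phi' -> sympow psi' ->
              {ae P, forall w, CI f w = I phi' w +i* I psi' w} ->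
              phi' = phi /\ psi' = psi]].
Proof.
move=> re im.
have s_re := sympow_re_kernel pq_gt0 TR e b.
have s_im := sympow_im_kernel pq_gt0 TR e b.
have [LRe LIm] := cwi_L2 CIP f_sym.
have hre := L2_sum_re isoX isoY HeP JP pq_gt0 etaP IP tenP xiP CIP f_sym f_sum.
have him := L2_sum_im isoX isoY HeP JP pq_gt0 etaP IP tenP xiP CIP f_sym f_sum.
split => //.
have [phi [sphi phi_sum phiE]] := wi_has_sum HeP IP s_re LRe hre.
have [psi [spsi psi_sum psiE]] := wi_has_sum HeP IP s_im LIm him.
exists phi, psi; split => //.
  by apply: filterS2 phiE psiE => w -> ->; case: (CI f w).
move=> phi' psi' sphi' spsi' CIE; split.
  apply: (wi_kernel_unique IP sphi' sphi).
  by apply: filterS2 phiE CIE => w -> ->.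
apply: (wi_kernel_unique IP spsi' spsi).
by apply: filterS2 psiE CIE => w -> ->.
Qed.
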